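(* Let $0<p<1$ be a constant. For each $n\ge 1$ let $X_n$ be the number of perfect matchings in the random bipartite graph $G(n,n,p)$, where the graphs $G(n,n,p)$, $n\ge1$, are the nested finite subgraphs of a single infinite random bipartite graph $G(\mathbb N,\mathbb N,p)$. Set $Y_n:=\log X_n$. Then $$\mathbf{P}\left[\limsup_{n\to\infty}\frac{Y_n-\log(n!\,p^n)}{\sqrt{2\log\log n}\,\sqrt{\frac{1-p}{p}}}=1\right]=1.$$
   Context: All logarithms are natural. $G(\mathbb N,\mathbb N,p)$ is the infinite random bipartite graph whose two color classes are each a copy of the natural numbers $\{1,2,\dots\}$, and in which any two vertices $i,j$ from different classes are joined by an edge independently with probability $p$. $G(n,n,p)$ is the finite subgraph of it spanned by the first $n$ vertices $1,\dots,n$ in each color class. Equivalently, if $(\xi_{ij})_{i,j\ge1}$ are iid Bernoulli variables with $\mathbf P[\xi_{ij}=1]=p=1-\mathbf P[\xi_{ij}=0]$, then row-vertex $i$ is joined to column-vertex $j$ iff $\xi_{ij}=1$, and $X_n$ is the permanent of $(\xi_{ij})_{1\le i,j\le n}$. By convention $\log 0=-\infty$; the ratio is considered for $n\ge 3$, so that $\log\log n>0$. *)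

(* Defs.v *)
From HB Require Import structures.
From mathcomp Require Import all_boot all_order all_algebra finmap.
From mathcomp Require Import all_classical all_reals all_analysis.

Set Implicit Arguments.
Unset Strict Implicit.
Unset Printing Implicit Defensive.

Import Order.TTheory GRing.Theory Num.Theory.
Import numFieldNormedType.Exports.

Local Open Scope classical_set_scope.
Local Open Scope ring_scope.

(* A bipartite graph with color classes U and V is given by its adjacency
   predicate e : U -> V -> bool; an edge is the pair (u, v) of its endpoints. *)
Definition perfect_matching (U V : finType) (e : U -> V -> bool)
    (M : {set U * V}) : bool :=
  [&& [forall m in M, e m.1 m.2],
      [forall u : U, #|[set m in M | m.1 == u]%SET| == 1%N] &
      [forall v : V, #|[set m in M | m.2 == v]%SET| == 1%N]].

Definition nb_perfect_matchings (U V : finType) (e : U -> V -> bool) : nat :=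
  #|[set M : {set U * V} | perfect_matching e M]%SET|.

Definition mutually_independent (d d' : measure_display) (T : measurableType d)
    (T' : measurableType d') (R : realType) (P : probability T R)
    (I : choiceType) (X : I -> {RV P >-> T'}) : Prop :=
  forall (J : {fset I}) (A : I -> set T'), (forall i, measurable (A i)) ->
    P (\bigcap_(i in [set` J]) (X i @^-1` A i)) =
      (\prod_(i <- J) P (X i @^-1` A i))%E.

(* G (i, j) is the indicator of the edge joining row-vertex i to column-vertex
   j of G(N, N, p). Vertices are numbered from 0. *)
Definition random_bipartite_graph (d : measure_display) (T : measurableType d)
    (R : realType) (P : probability T R) (p : R)
    (G : nat * nat -> {RV P >-> bool}) : Prop :=
  mutually_independent G /\ forall ij, P (G ij @^-1` [set true]) = p%:E.

(* G(n, n, p): the subgraph spanned by the first n vertices of each class. *)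
Definition finite_subgraph (d : measure_display) (T : measurableType d)
    (R : realType) (P : probability T R) (G : nat * nat -> {RV P >-> bool})
    (n : nat) (t : T) : 'I_n -> 'I_n -> bool :=
  fun i j => G (i : nat, j : nat) t.

Definition X (d : measure_display) (T : measurableType d) (R : realType)
    (P : probability T R) (G : nat * nat -> {RV P >-> bool})
    (n : nat) (t : T) : nat :=
  nb_perfect_matchings (finite_subgraph G (n := n) t).

(* Extended-real valued, since lne 0 = -oo. *)
Definition Y (d : measure_display) (T : measurableType d) (R : realType)
    (P : probability T R) (G : nat * nat -> {RV P >-> bool})
    (n : nat) (t : T) : \bar R :=
  lne (X G n t)%:R%:E.

(* Main.v *)
From HB Require Import structures.
Require Import Defs.
From mathcomp Require Import all_boot all_order all_algebra finmap.
From mathcomp Require Import all_classical all_reals all_analysis.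
From mathcomp Require Import ring lra measurable_realfun.

(** Up to a bounded factor, the number of perfect matchings is a function of the
    number of edges. Let [S_n] be the number of edges of the [n] by [n] subgraph minus
    its mean [n^2 p]. Almost surely, for all large [n],
      [log X_n = log (n! p^n) + S_n / (n p) + O(1)],
    and the error [O(1)] disappears after division by [sqrt (log log n)]. Since [S_n]
    is a sum of [n^2] independent centred Bernoulli variables and
    [log log (n^2) ~ log log n], the law of the iterated logarithm bounds it by
    [n sqrt (2 p (1 - p) log log n)], sharply; and [sqrt (p (1 - p)) / p] is
    [sqrt ((1 - p) / p)].

    For the comparison, the rows are revealed one at a time. Let [N_k] count the ways
    to choose distinct neighbours for the first [k] rows. Then
      [N_(k+1) = (n - k) p N_k (1 + D_k)],
    where [D_k] is a linear form in the centred entries of the new row; the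
    coefficient of column [j] is [1 / p] times the share [w_j] of [j] among all pairs
    of a choice and a column that this choice leaves free. If every [w_j] were
    [1 / n], then [D_k] would be the edge surplus of the new row divided by [n p], and
    these terms add up to [S_n / (n p)]. So one needs that the [w_j] are almost equal,
    that the centred remainders of the [D_k] have a bounded sum, and that
    [sum_k D_k^2] is bounded, as [D - D^2 <= log (1 + D) <= D].

    Equality of the [w_j]. Remove two columns [j] and [j'] and let [b_i] be the number
    of choices, in the remaining columns, for all revealed rows but [i]. The number of
    choices that avoid [j'] is [b + sum_i x_ij b_i], with [b] the number of choices for
    all revealed rows, and [b] and [b_i] do not depend on column [j]. Hence this number
    concentrates around [b + p sum_i b_i], which is symmetric in [j] and [j'], unless
    some [b_i] is a large part of the total. The rotation inequality [per_rotation],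
      [deg(i) b_i <= b + sum_l b_l],
    excludes that when the degrees are of order [n]: give row [i] a neighbour, and
    release the row that held it. This yields [per_del_flat] and [Pr_notflat] with a
    relative error [n^(-1/4)].

    Given this, exponential moments along the rows ([Ex_expR_cstep_sum],
    [Ex_expR_step_sqr_sum]) show that the comparison fails at [n] with probability
    [O(n^(-2))] ([Pr_not_typical]), and the Borel-Cantelli lemma applies.

    The law of the iterated logarithm for [S_n] is proved by the classical route. The
    upper half uses a maximal inequality for exponentials ([Sbox_max]) over geometric
    blocks of [n]; the lower half uses a lower bound for Bernoulli tails by change of
    measure ([Sset_lower_tail]) on the independent shells between the squares of side
    [c^k] and [c^(k+1)]. All estimates are made for finitely many edges, as weighted
    sums over configurations, and [restr_prob] carries them to the probability space. *)

Set Implicit Arguments.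
Unset Strict Implicit.
Unset Printing Implicit Defensive.

Import Order.TTheory GRing.Theory Num.Theory.
Import numFieldNormedType.Exports.

Local Open Scope classical_set_scope.
Local Open Scope ring_scope.

(** * Elementary inequalities for exp and ln *)

Section Calculus.
Context {R : realType}.
Implicit Types x y u : R.

Lemma incr_of_derive (f f' : R -> R) (a b : R) : a <= b ->
  (forall x, a <= x <= b -> is_derive x 1 f (f' x)) ->
  (forall x, a <= x <= b -> 0 <= f' x) -> f a <= f b.
Proof.
move=> ab df f'0.
have [->//|aNb] := eqVneq a b.
have ltab : a < b by rewrite lt_neqAle aNb.
have [] := @MVT R f f' a b ltab.
- by move=> x; rewrite in_itv/= => /andP[ax xb]; apply: df; rewrite !ltW.
- apply: derivable_within_continuous => x; rewrite in_itv/= => xab.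
  by have := df x xab => -[].
- move=> c; rewrite in_itv/= => /andP[ac cb] fE.
  rewrite -subr_ge0 fE mulr_ge0 ?subr_ge0// f'0// !ltW//.
Qed.

Lemma expR_le_deg2 y : y <= 0 -> expR y <= 1 + y + y ^+ 2 / 2.
Proof.
move=> y0.
pose f (x : R) := - ((1 + x + x ^+ 2 / 2) * expR (- x)).
pose f' (x : R) := x ^+ 2 / 2 * expR (- x).
have : f y <= f 0.
  apply: (@incr_of_derive f f' _ _ y0).
  - move=> x _; rewrite /f /f'; apply: is_derive_eq.
    by rewrite !scaler1 /GRing.scale /=; field.
  - by move=> x _; rewrite mulr_ge0 ?expR_ge0// divr_ge0// sqr_ge0.
rewrite /f oppr0 expR0 mulr1 expr0n/= mul0r !addr0 lerN2 expRN.
by rewrite ler_pdivlMr ?expR_gt0// mul1r.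
Qed.

Lemma expR_le_deg3 y : 0 <= y <= 1 -> expR y <= 1 + y + y ^+ 2 / 2 + y ^+ 3.
Proof.
move=> /andP[y0 y1].
pose f (x : R) := (1 + x + x ^+ 2 / 2 + x ^+ 3) * expR (- x).
pose f' (x : R) := x ^+ 2 * (5 / 2 - x) * expR (- x).
have : f 0 <= f y.
  apply: (@incr_of_derive f f' _ _ y0).
  - move=> x _; rewrite /f /f'; apply: is_derive_eq.
    by rewrite !scaler1 /GRing.scale /=; field.
  - move=> x /andP[x0 xy]; rewrite mulr_ge0 ?expR_ge0// mulr_ge0 ?sqr_ge0//.
    by lra.
rewrite /f oppr0 expR0 mulr1 !expr0n/= mul0r !addr0 expRN.
by rewrite ler_pdivlMr ?expR_gt0// mul1r.
Qed.

Lemma expR_le_cubic y : `|y| <= 1 ->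
  expR y <= 1 + y + y ^+ 2 / 2 + `|y| ^+ 3.
Proof.
have [y0 /= y1|y0 y1] := leP 0 y.
  by rewrite ger0_norm// expR_le_deg3 ?y0 //= -(ger0_norm y0).
by rewrite (le_trans (expR_le_deg2 (ltW y0)))// lerDl exprn_ge0.
Qed.

Lemma ln1D_le_cubic u : 0 <= u -> ln (1 + u) <= u - u ^+ 2 / 2 + u ^+ 3 / 3.
Proof.
move=> u0.
pose f (x : R) := x - x ^+ 2 / 2 + x ^+ 3 / 3 - ln (1 + x).
have : f 0 <= f u.
  apply: (@incr_of_derive f (fun x => x ^+ 3 / (1 + x)) _ _ u0).
  - move=> x /andP[x0 _]; rewrite /f.
    have x1 : 0 < 1 + x by lra.
    have := is_derive1_ln x1 => Hl.
    apply: is_derive_eq.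
    by rewrite !scaler1 /GRing.scale /=; field; lra.
  - by move=> x /andP[x0 xu]; rewrite divr_ge0 ?exprn_ge0//; lra.
rewrite /f addr0 ln1 !expr0n/= !mul0r subr0 !addr0 subr0.
by rewrite subr_ge0.
Qed.

Lemma ln1B_le_quad u : 0 <= u < 1 -> ln (1 - u) <= - u - u ^+ 2 / 2.
Proof.
move=> /andP[u0 u1].
pose f (x : R) := - x - x ^+ 2 / 2 - ln (1 - x).
have : f 0 <= f u.
  apply: (@incr_of_derive f (fun x => x ^+ 2 / (1 - x)) _ _ u0).
  - move=> x /andP[x0 xu]; rewrite /f.
    have x1 : 0 < 1 - x by lra.
    have := is_derive1_ln x1 => Hl.
    apply: is_derive_eq.
    by rewrite !scaler1 /GRing.scale /=; field; lra.
  - by move=> x /andP[x0 xu]; rewrite divr_ge0 ?exprn_ge0//; lra.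
rewrite /f subr0 oppr0 ln1 !expr0n/= !mul0r !subr0.
by rewrite subr_ge0.
Qed.

Lemma ln1D_ge_quad u : `|u| <= 2^-1 -> u - u ^+ 2 <= ln (1 + u).
Proof.
move=> u1.
have [u0|u0] := leP 0 u.
  pose f (x : R) := ln (1 + x) - (x - x ^+ 2).
  have : f 0 <= f u.
    apply: (@incr_of_derive f (fun x => x * (1 + 2 * x) / (1 + x)) _ _ u0).
    - move=> x /andP[x0 xu]; rewrite /f.
      have x1 : 0 < 1 + x by lra.
      have := is_derive1_ln x1 => Hl.
      apply: is_derive_eq.
      by rewrite !scaler1 /GRing.scale /=; field; lra.
    - by move=> x /andP[x0 xu]; rewrite divr_ge0 ?mulr_ge0//; lra.
  by rewrite /f addr0 ln1 !expr0n/= !subr0 subr_ge0.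
pose f (x : R) := - (ln (1 + x) - (x - x ^+ 2)).
have uN : - 2^-1 <= u by move: u1; rewrite ltr0_norm//; lra.
have : f u <= f 0.
  apply: (@incr_of_derive f (fun x => - x * (1 + 2 * x) / (1 + x)) _ _ (ltW u0)).
  - move=> x /andP[x0 xu]; rewrite /f.
    have x1 : 0 < 1 + x by lra.
    have := is_derive1_ln x1 => Hl.
    apply: is_derive_eq.
    by rewrite !scaler1 /GRing.scale /=; field; lra.
  - by move=> x /andP[x0 xu]; rewrite divr_ge0 ?mulr_ge0//; lra.
by rewrite /f addr0 ln1 !expr0n/= !subr0 oppr0 oppr_le0 subr_ge0.
Qed.

End Calculus.

Lemma eq_lerW {R : numDomainType} (x y : R) : x = y -> x <= y.
Proof. by move=> ->. Qed.

(** * Expectations over finitely many independent bits *)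

Section FiniteProduct.
Context {R : realType} {I : finType}.
Implicit Types (q : I -> R) (A : pred I) (x y : {ffun I -> bool}).
Implicit Types (E F : {ffun I -> bool} -> bool).

Definition weight q x : R := \prod_i (if x i then q i else 1 - q i).

(** The expectation of a function of independent bits, bit [i] being true with
    probability [q i]; [q] may vary with [i] so that a change of measure can affect
    only some of the bits. *)
Definition Ex q (f : {ffun I -> bool} -> R) : R := \sum_x weight q x * f x.

Definition Pr q (E : {ffun I -> bool} -> bool) : R := Ex q (fun x => (E x)%:R).

Lemma eq_Ex q f g : f =1 g -> Ex q f = Ex q g.
Proof. by move=> fg; apply: eq_bigr => x _; rewrite fg. Qed.

Lemma ExD q f g : Ex q (fun x => f x + g x) = Ex q f + Ex q g.
Proof.
by rewrite /Ex -big_split; apply: eq_bigr => x _; rewrite mulrDr.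
Qed.

Lemma ExZ q c f : Ex q (fun x => c * f x) = c * Ex q f.
Proof.
by rewrite /Ex big_distrr; apply: eq_bigr => x _; rewrite mulrCA.
Qed.

Lemma Ex_sum q (J : Type) (s : seq J) (Q : pred J)
    (f : J -> {ffun I -> bool} -> R) :
  Ex q (fun x => \sum_(j <- s | Q j) f j x) = \sum_(j <- s | Q j) Ex q (f j).
Proof.
rewrite /Ex exchange_big; apply: eq_bigr => x _.
by rewrite big_distrr.
Qed.

Lemma Ex_prod q (g : I -> bool -> R) :
  Ex q (fun x => \prod_i g i (x i)) =
  \prod_i (q i * g i true + (1 - q i) * g i false).
Proof.
under [RHS]eq_bigr => i _.
  rewrite -(big_bool _ (fun b => (if b then q i else 1 - q i) * g i b)).
  over.
rewrite bigA_distr_bigA; apply: eq_bigr => x _.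
by rewrite /weight -big_split.
Qed.

Lemma Ex_cst q c : Ex q (fun=> c) = c.
Proof.
rewrite -[in LHS](mulr1 c) ExZ.
have -> : Ex q (fun=> 1) = Ex q (fun x => \prod_i (fun _ _ => 1) i (x i)).
  by apply: eq_Ex => x; rewrite big1.
rewrite (Ex_prod q (fun _ _ => 1)) big1 ?mulr1// => i _.
by rewrite !mulr1 addrC subrK.
Qed.

Lemma Ex_coord q i (h : bool -> R) :
  Ex q (fun x => h (x i)) = q i * h true + (1 - q i) * h false.
Proof.
pose g j b := if j == i then h b else 1.
rewrite (@eq_Ex _ _ (fun x => \prod_j g j (x j))); last first.
  move=> x; rewrite (bigD1 i)//= big1 /g ?eqxx ?mulr1// => j ji.
  by rewrite (negbTE ji).
rewrite Ex_prod (bigD1 i)//= big1 /g ?eqxx ?mulr1// => j ji.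
by rewrite (negbTE ji) !mulr1 addrC subrK.
Qed.

Section Weighted.
Variable q : I -> R.
Hypothesis q01 : forall i, 0 <= q i <= 1.

Lemma weight_ge0 x : 0 <= weight q x.
Proof.
apply: prodr_ge0 => i _; have /andP[q0 q1] := q01 i.
by case: ifP => // _; rewrite subr_ge0.
Qed.

Lemma le_Ex f g : (forall x, f x <= g x) -> Ex q f <= Ex q g.
Proof. by move=> fg; apply: ler_sum => x _; rewrite ler_wpM2l// weight_ge0. Qed.

Lemma Ex_ge0 f : (forall x, 0 <= f x) -> 0 <= Ex q f.
Proof. by move=> f0; apply: sumr_ge0 => x _; rewrite mulr_ge0// weight_ge0. Qed.

Lemma Pr_le E F : (forall x, E x -> F x) -> Pr q E <= Pr q F.
Proof.
move=> EF; apply: le_Ex => x.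
by have := EF x; case: (E x) => [->//|_]; exact: ler0n.
Qed.

Lemma Pr_ge0 E : 0 <= Pr q E.
Proof. exact: Ex_ge0. Qed.

Lemma Pr_C E : Pr q (fun x => ~~ E x) = 1 - Pr q E.
Proof.
rewrite -[X in X - _](Ex_cst q) -[X in _ - X]mul1r -mulNr -ExZ -ExD.
by apply: eq_Ex => x; case: (E x); rewrite /= ?mulr1 ?mulr0 ?subrr ?addr0.
Qed.

Lemma Pr_or E F : Pr q (fun x => E x || F x) <= Pr q E + Pr q F.
Proof.
rewrite -ExD; apply: le_Ex => x.
by case: (E x); case: (F x); rewrite ?addr0 ?add0r ?lerDl.
Qed.

Lemma Pr_has (J : Type) (s : seq J) (E : J -> {ffun I -> bool} -> bool) :
  Pr q (fun x => has (fun j => E j x) s) <= \sum_(j <- s) Pr q (E j).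
Proof.
elim: s => [|j s ih]; first by rewrite big_nil /Pr /= Ex_cst.
by rewrite big_cons (le_trans (Pr_or _ _))// lerD2l.
Qed.

Lemma markov_Pr E f : (forall x, 0 <= f x) -> (forall x, E x -> 1 <= f x) ->
  Pr q E <= Ex q f.
Proof.
by move=> f0 Ef; apply: le_Ex => x; case: (boolP (E x)) => [/Ef|].
Qed.

End Weighted.

(** Resampling: keep the bits of [x] on [A], take those of [y] elsewhere. *)
Definition merge A x y : {ffun I -> bool} :=
  [ffun i => if A i then x i else y i].

Definition dep {Z : Type} A (f : {ffun I -> bool} -> Z) :=
  forall x y, (forall i, A i -> x i = y i) -> f x = f y.

Lemma dep_mergel Z A (f : _ -> Z) x y : dep A f -> f (merge A x y) = f x.
Proof. by apply => i Ai; rewrite ffunE Ai. Qed.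

Lemma dep_merger Z A (f : _ -> Z) x y :
  dep (predC A) f -> f (merge A x y) = f y.
Proof. by apply => i /negbTE /= Ai; rewrite ffunE Ai. Qed.

Lemma dep_sub Z A B (f : _ -> Z) : subpred A B -> dep A f -> dep B f.
Proof. by move=> AB fA x y xy; apply: fA => i /AB /xy. Qed.

(** Swapping the coordinates of [A] between two independent copies is an involution
    that preserves the product weight, so resampling does not change the law. This is
    the form in which conditional expectations are used: the outer [x] is the
    conditioning, the inner [y] the fresh randomness. *)
Lemma Ex_merge q A f :
  Ex q f = Ex q (fun x => Ex q (fun y => f (merge A x y))).
Proof.
pose sw (u : {ffun I -> bool} * {ffun I -> bool}) :=
  (merge A u.1 u.2, merge A u.2 u.1).
have swK : involutive sw.
  move=> [x y]; rewrite /sw/=; congr pair; apply/ffunP => i;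
    by rewrite !ffunE; case: (A i).
have -> : Ex q f = \sum_u weight q u.1 * weight q u.2 * f u.1.
  rewrite -(pair_bigA _ (fun x y => weight q x * weight q y * f x))/=.
  apply: eq_bigr => x _.
  under eq_bigr => y _ do rewrite mulrAC.
  rewrite -big_distrr/=.
  have -> : \sum_i weight q i = 1.
    by rewrite -[RHS](Ex_cst q); apply: eq_bigr => y _; rewrite mulr1.
  by rewrite mulr1.
rewrite (reindex_inj (inv_inj swK))/=.
rewrite -(pair_bigA _ (fun x y =>
  weight q (merge A x y) * weight q (merge A y x) * f (merge A x y)))/=.
apply: eq_bigr => x _; rewrite big_distrr/=; apply: eq_bigr => y _.
rewrite mulrA; congr (_ * _).
rewrite /weight -!big_split/=; apply: eq_bigr => i _.
by rewrite !ffunE; case: (A i) => //; rewrite mulrC.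
Qed.

Lemma Ex_indep q A f g : dep A f -> dep (predC A) g ->
  Ex q (fun x => f x * g x) = Ex q f * Ex q g.
Proof.
move=> fA gA; rewrite (Ex_merge q A).
under eq_Ex => x.
  under eq_Ex => y do rewrite (dep_mergel _ _ fA) (dep_merger _ _ gA).
  rewrite ExZ mulrC; over.
by rewrite ExZ mulrC.
Qed.

(** A conditional bound is enough, and it is required only where the factor that is
    already determined does not vanish; indicators of favourable events can thus be
    put in [F]. *)
Lemma Ex_cond_le q A (F Phi : {ffun I -> bool} -> R) c : (forall i, 0 <= q i <= 1) ->
  dep A F -> (forall x, 0 <= F x) ->
  (forall x, F x != 0 -> Ex q (fun y => Phi (merge A x y)) <= c) ->
  Ex q (fun x => F x * Phi x) <= c * Ex q F.
Proof.
move=> q01 FA F0 le_c; rewrite (Ex_merge q A) -ExZ; apply: le_Ex => // x.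
under eq_Ex => y do rewrite (dep_mergel _ _ FA).
rewrite ExZ mulrC; have [->|/le_c Hc] := eqVneq (F x) 0.
  by rewrite !mulr0.
by rewrite ler_wpM2r.
Qed.

Lemma Pr_cond_le q A E c : (forall i, 0 <= q i <= 1) ->
  (forall x, Pr q (fun y => E (merge A x y)) <= c) -> Pr q E <= c.
Proof.
move=> q01 le_c; rewrite /Pr (Ex_merge q A) -[leRHS](Ex_cst q).
exact: le_Ex.
Qed.

End FiniteProduct.

Lemma Ex_centered {R : realType} {I : finType} (q c : I -> R) :
  Ex q (fun x => \sum_i c i * ((x i)%:R - q i)) = 0.
Proof.
rewrite Ex_sum big1// => i _.
rewrite (@Ex_coord _ _ _ i (fun b => c i * (b%:R - q i))).
by rewrite /= mulr1n mulr0n; ring.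
Qed.

Lemma Ex_sqr {R : realType} {I : finType} (q c : I -> R) :
  Ex q (fun x => (\sum_i c i * ((x i)%:R - q i)) ^+ 2) =
  \sum_i c i ^+ 2 * (q i * (1 - q i)).
Proof.
under eq_Ex => x do rewrite expr2 big_distrl/=.
rewrite Ex_sum; apply: eq_bigr => i _.
under eq_Ex => x do rewrite big_distrr/=.
rewrite Ex_sum (bigD1 i)//= [X in _ + X]big1 ?addr0; last first.
  move=> j ji.
  rewrite (@Ex_indep _ _ _ (pred1 i)).
  - rewrite (@Ex_coord _ _ _ j (fun b => c j * (b%:R - q j))).
    by rewrite [X in _ * X](_ : _ = 0) ?mulr0//= mulr1n mulr0n; ring.
  - by move=> x y xy; rewrite xy//= eqxx.
  - by move=> x y xy; rewrite xy//=.
rewrite (@Ex_coord _ _ _ i (fun b => c i * (b%:R - q i) * (c i * (b%:R - q i)))).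
by rewrite /= mulr1n mulr0n; ring.
Qed.

(** * Exponential bounds for linear forms in Bernoulli variables *)

Section Hoeffding.
Context {R : realType} {I : finType}.
Variable p : R.
Hypothesis p01 : 0 <= p <= 1.
Implicit Types (c : I -> R).

Notation E := (Ex (fun _ : I => p)).
Notation PP := (Pr (fun _ : I => p)).

Definition lin c (x : {ffun I -> bool}) : R := \sum_i c i * ((x i)%:R - p).

Lemma lin_const_scale c t x : lin (fun i => t * c i) x = t * lin c x.
Proof. by rewrite /lin big_distrr; apply: eq_bigr => i _; rewrite /= -mulrA. Qed.

(** The exact variance [p (1 - p)] and the constant [1/2] at leading order make the
    law of the iterated logarithm sharp; elsewhere [Ex_expR_lin_crude] suffices. *)
Lemma mgf_bernoulli (c : R) : `|c| <= 1 ->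
  p * expR (c * (1 - p)) + (1 - p) * expR (c * (0 - p)) <=
  expR (p * (1 - p) * (c ^+ 2 * (2^-1 + `|c|))).
Proof.
move=> c1; have /andP[p0 p1] := p01.
have key (t : R) : `|t| <= 1 ->
    expR (c * t) <= 1 + c * t + c ^+ 2 * t ^+ 2 * (2^-1 + `|c|).
  move=> t1.
  have ct1 : `|c * t| <= 1 by rewrite normrM mulr_ile1.
  apply: (le_trans (expR_le_cubic ct1)).
  rewrite normrM !exprMn mulrDr addrA -!addrA !lerD2l.
  rewrite -(real_normK (num_real c)) -(real_normK (num_real t)).
  rewrite -!mulrA.
  have := normr_ge0 c; have := normr_ge0 t.
  move: (`|c|) (`|t|) c1 t1 => a b a1 b1 b0 a0.
  have : 0 <= a ^+ 3 * b ^+ 2 * (1 - b).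
    by rewrite mulr_ge0 ?subr_ge0// mulr_ge0// exprn_ge0.
  by move=> h; rewrite -subr_ge0; apply: (le_trans h); apply/eq_lerW; ring.
have k1 := key (1 - p); have k2 := key (0 - p).
have {}k1 := ler_wpM2l p0 (k1 _).
have p1' : 0 <= 1 - p by lra.
have {}k2 := ler_wpM2l p1' (k2 _).
apply: (le_trans (lerD (k1 _) (k2 _))).
- by rewrite ger0_norm; lra.
- by rewrite sub0r normrN ger0_norm; lra.
apply: le_trans (expR_ge1Dx _).
by apply/eq_lerW; ring.
Qed.

Lemma Ex_expR_lin c : (forall i, `|c i| <= 1) ->
  E (fun x => expR (lin c x)) <=
  expR (p * (1 - p) * \sum_i (c i ^+ 2 * (2^-1 + `|c i|))).
Proof.
move=> c1; have /andP[p0 p1] := p01.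
rewrite (@eq_Ex _ _ _ _ (fun x => \prod_i expR (c i * ((x i)%:R - p)))).
  rewrite (Ex_prod _ (fun i b => expR (c i * (b%:R - p)))) big_distrr expR_sum.
  apply: ler_prod => i _; rewrite mgf_bernoulli// andbT.
  by rewrite addr_ge0// mulr_ge0 ?expR_ge0// subr_ge0.
by move=> x; rewrite /lin expR_sum.
Qed.

Lemma p1p_le : 0 <= p * (1 - p) <= 4^-1.
Proof.
have /andP[p0 p1] := p01; rewrite mulr_ge0 ?subr_ge0//=.
have := sqr_ge0 (p - 2^-1); rewrite sqrrB; lra.
Qed.

Lemma Ex_expR_lin_crude c : (forall i, `|c i| <= 1) ->
  E (fun x => expR (lin c x)) <= expR (\sum_i c i ^+ 2).
Proof.
move=> c1; apply: (le_trans (Ex_expR_lin c1)).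
rewrite ler_expR big_distrr/=; apply: ler_sum => i _.
have /andP[s0 s1] := p1p_le.
rewrite mulrCA ler_piMr ?sqr_ge0//.
rewrite [leRHS](_ : 1 = 4^-1 * 4 :> R); last by rewrite mulVf.
by apply: ler_pM => //; have := normr_ge0 (c i); have := c1 i; lra.
Qed.

Lemma tail_lin c t u v : 0 <= t -> (forall i, `|t * c i| <= 1) ->
  t ^+ 2 * \sum_i c i ^+ 2 <= v ->
  PP (fun x => u < lin c x) <= expR (v - t * u).
Proof.
move=> t0 c1 cv.
have q01 : forall i : I, 0 <= p <= 1 by [].
apply: (@le_trans _ _ (E (fun x => expR (- (t * u)) * expR (lin (fun i => t * c i) x)))).
  apply: (markov_Pr q01) => x /=; first by rewrite mulr_ge0 ?expR_ge0.
  move=> ux; rewrite -expRD -expR0 ler_expR lin_const_scale addrC subr_ge0.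
  by rewrite ler_wpM2l// ltW.
rewrite ExZ addrC expRD ler_wpM2l ?expR_ge0//.
apply: (le_trans (Ex_expR_lin_crude c1)).
rewrite ler_expR (le_trans _ cv)// big_distrr/=.
by apply: ler_sum => i _; rewrite exprMn.
Qed.

Lemma tail_abs_lin c t u v : 0 <= t -> (forall i, `|t * c i| <= 1) ->
  t ^+ 2 * \sum_i c i ^+ 2 <= v ->
  PP (fun x => u < `|lin c x|) <= 2 * expR (v - t * u).
Proof.
move=> t0 c1 cv.
have q01 : forall i : I, 0 <= p <= 1 by [].
apply: (@le_trans _ _ (PP (fun x => (u < lin c x) || (u < lin (fun i => -1 * c i) x)))).
  apply: Pr_le => // x; rewrite lin_const_scale mulN1r.
  by case: (ger0P (lin c x)) => _ ->; rewrite ?orbT.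
rewrite mulr2n mulrDl mul1r (le_trans (Pr_or _ _ _))//.
apply: lerD; apply: tail_lin => //.
  by move=> i; rewrite mulN1r mulrN normrN.
by under eq_bigr do rewrite mulN1r sqrrN.
Qed.

Lemma Ex_lin_sqr c : E (fun x => lin c x ^+ 2) = p * (1 - p) * \sum_i c i ^+ 2.
Proof.
rewrite (Ex_sqr (fun=> p) c) big_distrr/=; apply: eq_bigr => i _.
by rewrite mulrC.
Qed.

End Hoeffding.

(** * Permanents of rows and columns *)

Definition del {T : eqType} (c : T) (C : seq T) := [seq x <- C | x != c].

Lemma delC {T : eqType} (c d : T) C : del c (del d C) = del d (del c C).
Proof. by rewrite /del -!filter_predI; apply: eq_filter => x /=; rewrite andbC. Qed.

Lemma del_id {T : eqType} (c : T) C : c \notin C -> del c C = C.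
Proof.
move=> cC; apply/all_filterP/allP => x xC.
by apply: contraNneq cC => <-.
Qed.

Lemma mem_del {T : eqType} (c : T) C x : (x \in del c C) = (x != c) && (x \in C).
Proof. by rewrite mem_filter. Qed.

Lemma del_uniq {T : eqType} (c : T) C : uniq C -> uniq (del c C).
Proof. exact: filter_uniq. Qed.

Lemma size_del {T : eqType} (c : T) C :
  uniq C -> c \in C -> size C = (size (del c C)).+1.
Proof.
move=> uC cC; rewrite /del size_filter.
by rewrite -(count_predC (pred1 c) C) count_uniq_mem// cC.
Qed.

Section Permanent.
Context {R : realType} {U V : eqType}.
Implicit Types (a : U -> V -> R) (s : seq U) (C : seq V).

(** The permanent of the rows [s] against the columns [C], expanded along the first
    row: the weighted number of injective choices of a column of [C] for every row. *)
Fixpoint per a s C : R :=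
  if s is r :: s' then \sum_(c <- C) a r c * per a s' (del c C) else 1.

Lemma per_ext a a' s C :
  (forall i c, i \in s -> c \in C -> a i c = a' i c) -> per a s C = per a' s C.
Proof.
elim: s C => [//|r s ih] C aa' /=.
apply: eq_big_seq => c cC; rewrite aa' ?mem_head//; congr (_ * _).
apply: ih => i d is_; rewrite mem_del => /andP[_ dC].
by rewrite aa'// in_cons is_ orbT.
Qed.

Lemma per_ge0 a s C : (forall i c, 0 <= a i c) -> 0 <= per a s C.
Proof.
move=> a0; elim: s C => [//|r s ih] C /=.
by apply: sumr_ge0 => c _; rewrite mulr_ge0.
Qed.

(** A choice of columns for the rows [s] leaves [size C - size s] columns free. *)
Lemma sum_per_del a s C : uniq C ->
  \sum_(j <- C) per a s (del j C) = ((size C)%:R - (size s)%:R) * per a s C.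
Proof.
elim: s C => [|r s ih] C uC /=.
  by rewrite big_const_seq count_predT iter_addr_0 subr0 mulr1.
under eq_bigr => j _ do rewrite big_filter.
rewrite (exchange_big_dep predT)//= big_distrr/=; apply: eq_big_seq => c cC.
under eq_bigl => j do rewrite eq_sym.
rewrite -big_filter -/(del c C).
under eq_bigr => j _ do rewrite delC.
rewrite -big_distrr/= ih ?del_uniq// (size_del uC cC).
by rewrite -[in RHS]addn1 -[in RHS](addn1 (size s)) !natrD; ring.
Qed.

(** Interchanging the first row with row [i] shows that the order of the rows is
    irrelevant. *)
Lemma per_row a s C i : uniq s -> i \in s ->
  per a s C = \sum_(c <- C) a i c * per a (del i s) (del c C).
Proof.
elim: s C => [//|r s ih] C /= /andP[rs us].
rewrite in_cons; have [-> _|ir /= is_] := eqVneq i r.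
  by rewrite /= del_id.
rewrite /= -/(del i s).
transitivity (\sum_(c <- C) \sum_(d <- C | d != c)
   a r c * (a i d * per a (del i s) (del d (del c C)))).
  by apply: eq_bigr => c _; rewrite (ih _ us is_) big_filter big_distrr.
rewrite (exchange_big_dep predT)//=; apply: eq_bigr => d _.
rewrite big_filter big_distrr/=.
under eq_bigl => j do rewrite eq_sym.
by apply: eq_bigr => c _; rewrite mulrCA delC.
Qed.

(** Column [j] is either free or taken by exactly one row. *)
Lemma per_col a s C j : uniq C -> uniq s -> j \in C ->
  per a s C = per a s (del j C) + \sum_(i <- s) a i j * per a (del i s) (del j C).
Proof.
elim: s C => [|r s ih] C uC /=; first by rewrite big_nil addr0.
move=> /andP[rs us] jC.
rewrite (bigD1_seq j)//= -big_filter -/(del j C) big_cons eqxx/= -/(del r s).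
rewrite (del_id rs) addrCA; congr (_ + _).
transitivity (\sum_(c <- del j C) (a r c * per a s (del c (del j C)) +
   \sum_(i <- s) a i j * (a r c * per a (del i s) (del c (del j C))))).
  apply: eq_big_seq => c; rewrite mem_del => /andP[cj cC].
  rewrite (ih (del c C)) ?del_uniq// ?mem_del 1?eq_sym ?cj// (delC j) mulrDr.
  congr (_ + _); rewrite big_distrr/=; apply: eq_bigr => i _.
  by rewrite mulrCA.
rewrite big_split/=; congr (_ + _).
rewrite exchange_big/=; apply: eq_big_seq => i is_.
have -> : r != i by apply: contraNneq rs => ->.
by rewrite /= -/(del i s) big_distrr.
Qed.

(** Give row [i] a column [c] with [a i c != 0] in a choice for the other rows: either
    [c] was free and one gets a choice for all rows, or [c] was held by a row [l], which
    becomes the new missing row. For 0-1 entries this map is injective; algebraically it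
    is the expansion along column [c] followed by that along row [i]. *)
Lemma per_rotation a s C i : (forall i c, 0 <= a i c <= 1) ->
  uniq s -> uniq C -> i \in s ->
  (\sum_(c <- C) a i c) * per a (del i s) C <=
  per a s C + \sum_(l <- s) per a (del l s) C.
Proof.
move=> a01 us uC is_.
have a0 k c : 0 <= a k c by have /andP[] := a01 k c.
rewrite big_distrl/=.
rewrite (eq_big_seq (fun c => a i c * per a (del i s) (del c C) +
  \sum_(l <- del i s) a i c * (a l c * per a (del l (del i s)) (del c C)))); last first.
  move=> c cC; rewrite (per_col a uC (del_uniq i us) cC) mulrDr.
  by rewrite big_distrr.
rewrite big_split/= -(per_row a C us is_) lerD2l exchange_big/=.
rewrite [leRHS](bigD1_seq i)//= -(big_filter s (fun l => l != i)) -/(del i s).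
rewrite ler_wpDl ?per_ge0//.
rewrite big_seq [leRHS]big_seq; apply: ler_sum => l.
rewrite mem_del => /andP[li ls].
rewrite (per_row a C (del_uniq l us) (_ : i \in del l s)); last first.
  by rewrite mem_del eq_sym li.
rewrite (delC i); apply: ler_sum => c _.
rewrite ler_wpM2l// ler_piMl ?per_ge0//.
by have /andP[] := a01 l c.
Qed.

(** * Equal weights of the columns: the deterministic estimate *)

Section Flatness.
Variables (a : U -> V -> R) (s : seq U) (C : seq V).
Hypotheses (a01 : forall i c, 0 <= a i c <= 1) (us : uniq s) (uC : uniq C).

(** The scale of the fluctuations: exposing one more column changes the permanent by a
    linear form with coefficients at most [near_per]. *)
Definition near_per := per a s C + \sum_(i <- s) per a (del i s) C.

Let a0 i c : 0 <= a i c. Proof. by have /andP[] := a01 i c. Qed.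

Lemma near_per_ge0 : 0 <= near_per.
Proof. by rewrite addr_ge0 ?per_ge0// sumr_ge0// => i _; rewrite per_ge0. Qed.

Variable d : R.
Hypothesis d0 : 0 < d.
Hypothesis deg : forall i, i \in s -> d <= \sum_(c <- C) a i c.

Lemma per_del_le i : i \in s -> per a (del i s) C <= near_per / d.
Proof.
move=> is_; rewrite ler_pdivlMr// mulrC.
apply: le_trans (per_rotation a01 us uC is_).
by rewrite ler_wpM2r ?per_ge0// deg.
Qed.

(** No single row carries more than a fraction [1 / d] of the total, so the Euclidean
    norm of the coefficients is smaller than their sum by a factor [sqrt d]. *)
Lemma sum_per_del_sqr :
  \sum_(i <- s) per a (del i s) C ^+ 2 <= near_per ^+ 2 / d.
Proof.
apply: (@le_trans _ _ (\sum_(i <- s) near_per / d * per a (del i s) C)).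
  rewrite big_seq [leRHS]big_seq; apply: ler_sum => i is_.
  by rewrite expr2 ler_wpM2r ?per_ge0// per_del_le.
have dge0 : 0 <= d by exact: ltW.
rewrite -big_distrr/= expr2 [leRHS]mulrAC ler_wpM2l ?divr_ge0 ?near_per_ge0//.
by rewrite /near_per lerDr per_ge0.
Qed.

End Flatness.

(** The permanent that avoids [j'] uses column [j] only through a linear form whose
    coefficients see neither [j] nor [j']. When both linear forms are close to [p] times
    the sum of the coefficients, the two permanents are close to the same number. *)
Lemma per_del_flat a s C j j' (p rho : R) : (forall i c, 0 <= a i c <= 1) ->
  uniq s -> uniq C -> j \in C -> j' \in C -> j != j' -> 0 < p <= 1 ->
  0 <= rho <= p / 2 ->
  let C' := del j (del j' C) in
  `|\sum_(i <- s) (a i j - p) * per a (del i s) C'| <= rho * near_per a s C' ->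
  `|\sum_(i <- s) (a i j' - p) * per a (del i s) C'| <= rho * near_per a s C' ->
  `|per a s (del j' C) - per a s (del j C)| <= 4 * rho / p * per a s (del j' C).
Proof.
move=> a01 us uC jC j'C jj' /andP[p0 p1] /andP[rho0 rhop] C'.
have a0 k c : 0 <= a k c by have /andP[] := a01 k c.
set Q := near_per a s C'.
have Q0 : 0 <= Q by exact: near_per_ge0.
set S := \sum_(i <- s) _ * _; set S' := \sum_(i <- s) _ * _ => SQ S'Q.
have E1 : per a s (del j' C) = per a s C' + p * \sum_(i <- s) per a (del i s) C' + S.
  rewrite (per_col a (del_uniq j' uC) us (_ : j \in del j' C)) ?mem_del ?jj'//.
  rewrite -/C' -addrA big_distrr/= -big_split/=; congr (_ + _).
  by apply: eq_bigr => i _; ring.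
have E2 : per a s (del j C) = per a s C' + p * \sum_(i <- s) per a (del i s) C' + S'.
  rewrite (per_col a (del_uniq j uC) us (_ : j' \in del j C)) ?mem_del 1?eq_sym ?jj'//.
  rewrite (delC j') -/C' -addrA big_distrr/= -big_split/=; congr (_ + _).
  by apply: eq_bigr => i _; ring.
have P0 : 0 <= per a s C' by exact: per_ge0.
have lower : p / 2 * Q <= per a s (del j' C).
  have SN : - (rho * Q) <= S by have := SQ; rewrite ler_norml => /andP[].
  have h1 : rho * Q <= p / 2 * Q by rewrite ler_wpM2r.
  have h2 : p * Q <= per a s C' + p * \sum_(i <- s) per a (del i s) C'.
    by rewrite /Q /near_per mulrDr lerD2r ler_piMl.
  rewrite E1; lra.
apply: (@le_trans _ _ (2 * (rho * Q))).
  rewrite E1 E2 opprD addrACA subrr add0r.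
  by apply: (le_trans (ler_normB _ _)); lra.
have -> : 2 * (rho * Q) = 4 / p * rho * (p / 2 * Q).
  by field; rewrite gt_eqF.
rewrite [leRHS](_ : _ = 4 / p * rho * per a s (del j' C)); last by ring.
by rewrite ler_wpM2l// mulr_ge0// divr_ge0// ltW.
Qed.

End Permanent.

Lemma expR_le1D3 {R : realType} (y : R) : 0 <= y <= 1 -> expR y <= 1 + 3 * y.
Proof.
move=> y01; have /andP[y0 y1] := y01.
apply: (le_trans (expR_le_deg3 y01)).
have y2 : y ^+ 2 <= y by rewrite expr2 ler_piMl.
have y3 : y ^+ 3 <= y by rewrite exprS ler_piMr// (le_trans y2).
by lra.
Qed.

(** * Revealing the rows one at a time *)

Section RowProcess.
Context {R : realType} {n : nat}.
Variable p : R.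
Hypotheses (n0 : (0 < n)%N) (p01 : 0 < p < 1).
Implicit Types (x y : {ffun 'I_n * 'I_n -> bool}) (s : seq 'I_n) (i j : 'I_n).
Implicit Types delta eta lam t u : R.

Notation E := (Ex (fun _ : 'I_n * 'I_n => p)).
Notation PP := (Pr (fun _ : 'I_n * 'I_n => p)).
Notation nR := (n%:R : R).

Let p0 : 0 < p. Proof. by case/andP: p01. Qed.
Let p1 : p < 1. Proof. by case/andP: p01. Qed.
Let p01w : 0 <= p <= 1. Proof. by rewrite !ltW. Qed.
Let q01 : forall _ : 'I_n * 'I_n, 0 <= p <= 1. Proof. by []. Qed.
Let nR0 : 0 < nR. Proof. by rewrite ltr0n. Qed.

Definition adj x i j : R := (x (i, j))%:R.
(** The permanent of the rows [s] against all the columns of the random matrix. Lists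
    grow at the head: [i :: s] is the situation after [s] when row [i] is revealed. *)
Definition rowper x s : R := per (adj x) s (enum 'I_n).
Definition rowper_avoid x s j : R := per (adj x) s (del j (enum 'I_n)).
Definition rowper_avoid_sum x s : R := \sum_j rowper_avoid x s j.

Lemma adj01 x i j : 0 <= adj x i j <= 1.
Proof. by rewrite /adj ler0n lern1 leq_b1. Qed.

Lemma adj_ge0 x i j : 0 <= adj x i j.
Proof. by rewrite ler0n. Qed.

Lemma rowper_avoid_ge0 x s j : 0 <= rowper_avoid x s j.
Proof. exact: per_ge0 (adj_ge0 x). Qed.

Lemma rowper_avoid_sum_ge0 x s : 0 <= rowper_avoid_sum x s.
Proof. by apply: sumr_ge0 => j _; exact: rowper_avoid_ge0. Qed.

Lemma rowper_avoid_sumE x s : rowper_avoid_sum x s = (nR - (size s)%:R) * rowper x s.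
Proof. by rewrite /rowper_avoid_sum -big_enum/= sum_per_del ?enum_uniq// size_enum_ord. Qed.

Lemma rowper_cons x s i : rowper x (i :: s) = \sum_j adj x i j * rowper_avoid x s j.
Proof. by rewrite /rowper /= big_enum. Qed.

(** When some choice exists, the probability that [j] is the column picked, if a
    uniform choice for the rows [s] is followed by a uniform pick among the columns that
    it leaves free. *)
Definition avoid_share x s j := rowper_avoid x s j / rowper_avoid_sum x s.
(** Equal to [avoid_share - 1 / n] when some choice exists, and to 0 otherwise; with
    this convention flatness bounds it by [delta / n] in both cases. *)
Definition avoid_dev x s j := (rowper_avoid x s j - rowper_avoid_sum x s / nR) / rowper_avoid_sum x s.
Definition flat (delta : R) x s :=
  [forall j, `|rowper_avoid x s j - rowper_avoid_sum x s / nR| <= delta * (rowper_avoid_sum x s / nR)].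

(** The relative increment of the permanent with respect to its conditional mean when
    row [i] is revealed. *)
Definition step x s i := \sum_j avoid_share x s j / p * ((x (i, j))%:R - p).
(** What remains of the increment after removal of the edge surplus of the row. *)
Definition cstep x s i := \sum_j avoid_dev x s j / p * ((x (i, j))%:R - p).
Definition rowdev x i := \sum_j ((x (i, j))%:R - p).

Lemma avoid_share_ge0 x s j : 0 <= avoid_share x s j.
Proof. by rewrite divr_ge0 ?rowper_avoid_ge0 ?rowper_avoid_sum_ge0. Qed.

Lemma step_split x s i : 0 < rowper_avoid_sum x s ->
  step x s i = cstep x s i + rowdev x i / (nR * p).
Proof.
move=> T0; rewrite /rowdev big_distrl -big_split; apply: eq_bigr => j _ /=.
rewrite /avoid_share /avoid_dev; field.
by rewrite !gt_eqF.
Qed.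

(** The conditional mean of the new permanent is [(n - size s) p] times the old one,
    because the shares [avoid_share] sum to 1. *)
Lemma rowper_step x s i : 0 < rowper_avoid_sum x s ->
  rowper x (i :: s) = (nR - (size s)%:R) * p * rowper x s * (1 + step x s i).
Proof.
move=> T0; rewrite rowper_cons.
have -> : (nR - (size s)%:R) * p * rowper x s = rowper_avoid_sum x s * p.
  by rewrite rowper_avoid_sumE mulrAC.
have -> : 1 + step x s i = \sum_j avoid_share x s j / p * adj x i j.
  have w1 : \sum_j avoid_share x s j = 1.
    by rewrite -big_distrl/= -/(rowper_avoid_sum x s) divff// gt_eqF.
  rewrite -[in LHS]w1 -big_split/=; apply: eq_bigr => j _.
  by rewrite /adj; field; rewrite gt_eqF.
rewrite big_distrr/=; apply: eq_bigr => j _.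
by rewrite /avoid_share; field; rewrite !gt_eqF.
Qed.

Lemma avoid_dev_le delta x s j : 0 <= delta -> flat delta x s -> `|avoid_dev x s j| <= delta / nR.
Proof.
move=> d0 /forallP/(_ j); rewrite /avoid_dev.
have [->|T0] := eqVneq (rowper_avoid_sum x s) 0.
  by rewrite invr0 mulr0 normr0 divr_ge0.
have {}T0 : 0 < rowper_avoid_sum x s by rewrite lt_neqAle eq_sym T0 rowper_avoid_sum_ge0.
by rewrite normrM normfV (gtr0_norm T0) ler_pdivrMr// mulrAC -mulrA.
Qed.

Lemma avoid_share_le delta x s j : 0 <= delta <= 1 -> flat delta x s -> avoid_share x s j <= 2 / nR.
Proof.
move=> /andP[d0 d1] fl.
have [T0|T0] := eqVneq (rowper_avoid_sum x s) 0.
  by rewrite /avoid_share T0 invr0 mulr0 divr_ge0.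
have -> : avoid_share x s j = avoid_dev x s j + nR^-1.
  by rewrite /avoid_share /avoid_dev; field; rewrite T0 gt_eqF.
have := avoid_dev_le j d0 fl; rewrite ler_norml => /andP[_ h].
have : delta / nR <= 1 / nR by rewrite ler_wpM2r// invr_ge0 ltW.
by lra.
Qed.

Lemma sum_row (i : 'I_n) (F : 'I_n -> R) :
  \sum_(ij : 'I_n * 'I_n) (if ij.1 == i then F ij.2 else 0) = \sum_j F j.
Proof.
rewrite -(pair_bigA _ (fun a b => if a == i then F b else 0))/=.
rewrite (bigD1 i)//= eqxx [X in _ + X]big1 ?addr0// => k ki.
by rewrite (negbTE ki) big1.
Qed.

Lemma sum_col (j : 'I_n) s (F : 'I_n -> R) : uniq s ->
  \sum_(ij : 'I_n * 'I_n) (if (ij.2 == j) && (ij.1 \in s) then F ij.1 else 0) =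
  \sum_(i <- s) F i.
Proof.
move=> us.
rewrite -(pair_bigA _ (fun a b => if (b == j) && (a \in s) then F a else 0))/=.
rewrite exchange_big/= (bigD1 j)//= eqxx/= [X in _ + X]big1 ?addr0; last first.
  by move=> k kj; rewrite (negbTE kj) big1.
by rewrite -big_mkcond/= big_uniq.
Qed.

(** The coefficients on all cells of a linear form that lives on row [i]; those of
    [col_coef] live on column [j]. *)
Definition row_coef i (v : 'I_n -> R) (ij : 'I_n * 'I_n) : R :=
  if ij.1 == i then v ij.2 else 0.

Lemma lin_row_coef i v x : lin p (row_coef i v) x = \sum_j v j * ((x (i, j))%:R - p).
Proof.
rewrite /lin -(sum_row i); apply: eq_bigr => -[k j] _ /=.
by rewrite /row_coef/=; case: eqP => [->//|_]; rewrite mul0r.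
Qed.

Lemma sum_row_coef_sqr i v : \sum_ij row_coef i v ij ^+ 2 = \sum_j v j ^+ 2.
Proof.
rewrite -(sum_row i); apply: eq_bigr => -[k j] _ /=.
by rewrite /row_coef/=; case: eqP => // _; rewrite expr0n.
Qed.

Lemma row_coef_le i v (b : R) : 0 <= b -> (forall j, `|v j| <= b) ->
  forall ij, `|row_coef i v ij| <= b.
Proof. by move=> b0 vb ij; rewrite /row_coef; case: ifP => // _; rewrite normr0. Qed.

Definition col_coef j s (v : 'I_n -> R) (ij : 'I_n * 'I_n) : R :=
  if (ij.2 == j) && (ij.1 \in s) then v ij.1 else 0.

Lemma lin_col_coef j s v x : uniq s ->
  lin p (col_coef j s v) x = \sum_(i <- s) v i * ((x (i, j))%:R - p).
Proof.
move=> us; rewrite /lin -(sum_col j _ us); apply: eq_bigr => -[i k] _ /=.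
by rewrite /col_coef/=; case: eqP => [->|_]/=; [case: ifP => //|]; rewrite mul0r.
Qed.

Lemma sum_col_coef_sqr j s v : uniq s ->
  \sum_ij col_coef j s v ij ^+ 2 = \sum_(i <- s) v i ^+ 2.
Proof.
move=> us; rewrite -(sum_col j _ us); apply: eq_bigr => -[i k] _ /=.
by rewrite /col_coef/=; case: ifP => // _; rewrite expr0n.
Qed.

Definition rows s : pred ('I_n * 'I_n) := fun ij => ij.1 \in s.

Lemma rows_consr s i ij : rows s ij -> rows (i :: s) ij.
Proof. by rewrite /rows in_cons => /= ->; rewrite orbT. Qed.

Lemma dep_rowper_avoid s j : dep (rows s) (fun x => rowper_avoid x s j).
Proof.
by move=> x y xy; apply: per_ext => i c is_ _; rewrite /adj xy.
Qed.

Lemma dep_rowper_avoid_sum s : dep (rows s) (fun x => rowper_avoid_sum x s).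
Proof. by move=> x y xy; apply: eq_bigr => j _; exact: dep_rowper_avoid. Qed.

Lemma dep_avoid_share s j : dep (rows s) (fun x => avoid_share x s j).
Proof. by move=> x y xy; rewrite /avoid_share (dep_rowper_avoid _ xy) (dep_rowper_avoid_sum xy). Qed.

Lemma dep_avoid_dev s j : dep (rows s) (fun x => avoid_dev x s j).
Proof. by move=> x y xy; rewrite /avoid_dev (dep_rowper_avoid _ xy) (dep_rowper_avoid_sum xy). Qed.

Lemma dep_flat delta s : dep (rows s) (fun x => flat delta x s).
Proof.
move=> x y xy; apply: eq_forallb => j.
by rewrite (dep_rowper_avoid _ xy) (dep_rowper_avoid_sum xy).
Qed.

Lemma dep_step s i : dep (rows (i :: s)) (fun x => step x s i).
Proof.
move=> x y xy; apply: eq_bigr => j _; rewrite (dep_avoid_share j (y := y)).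
  by rewrite xy// /rows mem_head.
by move=> k ks; apply: xy; exact: rows_consr.
Qed.

Lemma dep_cstep s i : dep (rows (i :: s)) (fun x => cstep x s i).
Proof.
move=> x y xy; apply: eq_bigr => j _; rewrite (dep_avoid_dev j (y := y)).
  by rewrite xy// /rows mem_head.
by move=> k ks; apply: xy; exact: rows_consr.
Qed.

Lemma step_merge s i x y : i \notin s ->
  step (merge (rows s) x y) s i = \sum_j avoid_share x s j / p * ((y (i, j))%:R - p).
Proof.
move=> is_; apply: eq_bigr => j _.
by rewrite (dep_mergel _ _ (@dep_avoid_share s j)) ffunE /rows/= (negbTE is_).
Qed.

Lemma cstep_merge s i x y : i \notin s ->
  cstep (merge (rows s) x y) s i = \sum_j avoid_dev x s j / p * ((y (i, j))%:R - p).
Proof.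
move=> is_; apply: eq_bigr => j _.
by rewrite (dep_mergel _ _ (@dep_avoid_dev s j)) ffunE /rows/= (negbTE is_).
Qed.

(** The bound [eta] on the increments is part of the event so that the exponential of
    their squares can be bounded by a linear function. *)
Fixpoint tame delta eta x s : bool :=
  if s is i :: s' then
    [&& tame delta eta x s', flat delta x s' & `|step x s' i| <= eta]
  else true.
Fixpoint all_flat delta x s : bool :=
  if s is i :: s' then all_flat delta x s' && flat delta x s' else true.
Fixpoint cstep_sum x s : R := if s is i :: s' then cstep_sum x s' + cstep x s' i else 0.
Fixpoint step_sqr_sum x s : R := if s is i :: s' then step_sqr_sum x s' + step x s' i ^+ 2 else 0.

Lemma dep_tame delta eta s : dep (rows s) (fun x => tame delta eta x s).
Proof.
elim: s => [//|i s ih] x y xy /=.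
have xy' : forall ij, rows s ij -> x ij = y ij.
  by move=> k ks; apply: xy; exact: rows_consr.
by rewrite (ih _ _ xy') (dep_flat _ xy') (dep_step xy).
Qed.

Lemma dep_all_flat delta s : dep (rows s) (fun x => all_flat delta x s).
Proof.
elim: s => [//|i s ih] x y xy /=.
have xy' : forall ij, rows s ij -> x ij = y ij.
  by move=> k ks; apply: xy; exact: rows_consr.
by rewrite (ih _ _ xy') (dep_flat _ xy').
Qed.

Lemma dep_cstep_sum s : dep (rows s) (fun x => cstep_sum x s).
Proof.
elim: s => [//|i s ih] x y xy /=.
have xy' : forall ij, rows s ij -> x ij = y ij.
  by move=> k ks; apply: xy; exact: rows_consr.
by rewrite (ih _ _ xy') (dep_cstep xy).
Qed.

Lemma dep_step_sqr_sum s : dep (rows s) (fun x => step_sqr_sum x s).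
Proof.
elim: s => [//|i s ih] x y xy /=.
have xy' : forall ij, rows s ij -> x ij = y ij.
  by move=> k ks; apply: xy; exact: rows_consr.
by rewrite (ih _ _ xy') (dep_step xy).
Qed.

(** Given the earlier rows, the new row is independent and the coefficients of [cstep]
    are at most [delta / (n p)], so each row multiplies the exponential moment by at most
    [1 + O((lam delta)^2 / n)]. Flatness is asked of the earlier rows only, hence is
    determined when the new row is drawn. *)
Lemma Ex_expR_cstep_sum delta lam s : uniq s -> 0 <= delta ->
  `|lam| * delta <= p * nR ->
  E (fun x => (all_flat delta x s)%:R * expR (lam * cstep_sum x s)) <=
  expR ((size s)%:R * ((lam * delta) ^+ 2 / (p ^+ 2 * nR))).
Proof.
move=> + d0 lamd; elim: s => [_|i s ih /= /andP[is_ us]].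
  by rewrite mul0r expR0 (@eq_Ex _ _ _ _ (fun=> 1)) ?Ex_cst// => x /=;
    rewrite mul1r mulr0 expR0.
set K := _ / _ in ih *.
rewrite (@eq_Ex _ _ _ _ (fun x => ((all_flat delta x s && flat delta x s)%:R *
    expR (lam * cstep_sum x s)) * expR (lam * cstep x s i))); last first.
  by move=> x; rewrite mulrDr expRD mulrA.
apply: (@le_trans _ _ (expR K * E (fun x => (all_flat delta x s && flat delta x s)%:R *
    expR (lam * cstep_sum x s)))).
  apply: (@Ex_cond_le _ _ _ (rows s)) => //.
  - by move=> x y xy; rewrite (dep_all_flat _ xy) (dep_flat _ xy) (dep_cstep_sum xy).
  move=> x; case: (boolP (flat delta x s)) => [fl _|_]; last by rewrite andbF mul0r eqxx.
  rewrite (@eq_Ex _ _ _ _ (fun y => expR (lin p (row_coef i (fun j => lam * (avoid_dev x s j / p))) y))); last first.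
    move=> y; rewrite cstep_merge// lin_row_coef big_distrr/=; congr expR.
    by apply: eq_bigr => j _; rewrite mulrA.
  have cb j : `|lam * (avoid_dev x s j / p)| <= `|lam| * delta / (p * nR).
    rewrite (normrM lam) (normrM (avoid_dev x s j)) normfV (gtr0_norm p0).
    rewrite [leRHS](_ : _ = `|lam| * (delta / nR / p)); last first.
      by field; rewrite !gt_eqF.
    by rewrite ler_wpM2l// ler_wpM2r ?invr_ge0 ?(ltW p0)// avoid_dev_le.
  apply: le_trans (Ex_expR_lin_crude p01w _) _.
    apply: row_coef_le => // j; apply: le_trans (cb j) _.
    by rewrite ler_pdivrMr ?mul1r// mulr_gt0.
  rewrite ler_expR sum_row_coef_sqr.
  apply: (@le_trans _ _ (\sum_(j < n) (`|lam| * delta / (p * nR)) ^+ 2)).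
    apply: ler_sum => j _; rewrite -real_normK ?num_real//.
    by rewrite lerXn2r ?nnegrE// divr_ge0 ?mulr_ge0// ltW.
  rewrite sumr_const card_ord -mulr_natr.
  rewrite !exprMn exprVn real_normK ?num_real// /K.
  apply: eq_lerW; field; by rewrite !gt_eqF.
rewrite -[(size s).+1]addn1 natrD mulrDl mul1r expRD mulrC.
rewrite ler_wpM2r ?expR_ge0//; apply: le_trans (ih us).
apply: le_Ex => // x; rewrite ler_wpM2r ?expR_ge0//.
by case: all_flat; rewrite /= ?ler_nat ?leq_b1.
Qed.

Lemma Pr_cstep_sum delta lam u s : uniq s -> 0 <= delta -> 0 <= lam ->
  lam * delta <= p ->
  PP (fun x => all_flat delta x s && (u < `|cstep_sum x s|)) <= 2 * expR (1 - lam * u).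
Proof.
move=> us d0 l0 ld.
have size_le : (size s)%:R <= nR.
  by rewrite ler_nat -[leqRHS]card_ord -(card_uniqP us) max_card.
have ldn : lam * delta <= p * nR.
  by apply: (le_trans ld); rewrite ler_peMr ?ler1n// ltW.
have side (e : R) : `|e| = 1 ->
    PP (fun x => all_flat delta x s && (u < e * cstep_sum x s)) <= expR (1 - lam * u).
  move=> e1.
  apply: (@le_trans _ _ (E (fun x => expR (- (lam * u)) *
      ((all_flat delta x s)%:R * expR ((e * lam) * cstep_sum x s))))).
    apply: markov_Pr => // x.
    move=> /andP[-> ux]; rewrite mul1r -expRD -[leLHS]expR0 ler_expR addrC subr_ge0.
    by rewrite -mulrA mulrCA ler_wpM2l// ltW.
  rewrite ExZ addrC expRD ler_wpM2l ?expR_ge0//.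
  apply: (le_trans (Ex_expR_cstep_sum us d0 _)).
    by rewrite normrM e1 mul1r (ger0_norm l0).
  have -> : (e * lam * delta) ^+ 2 = (lam * delta) ^+ 2.
    by rewrite -mulrA exprMn -(real_normK (num_real e)) e1 expr1n mul1r.
  rewrite ler_expR.
  apply: (@le_trans _ _ (nR * (p ^+ 2 / (p ^+ 2 * nR)))).
    apply: ler_pM => //.
      by rewrite divr_ge0 ?sqr_ge0// mulr_ge0 ?sqr_ge0// ltW.
    apply: ler_wpM2r; first by rewrite invr_ge0 mulr_ge0 ?sqr_ge0// ltW.
    by rewrite lerXn2r ?nnegrE ?mulr_ge0// ltW.
  by apply: eq_lerW; field; rewrite !gt_eqF.
apply: (@le_trans _ _ (PP (fun x => (all_flat delta x s && (u < 1 * cstep_sum x s)) ||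
    (all_flat delta x s && (u < -1 * cstep_sum x s))))).
  apply: Pr_le => // x /andP[-> /=]; rewrite mul1r mulN1r.
  by case: (ger0P (cstep_sum x s)) => _ ->; rewrite ?orbT.
rewrite mulr2n mulrDl mul1r (le_trans (Pr_or _ _ _))//.
by apply: lerD; apply: side; rewrite ?normrN normr1.
Qed.

(** On the event, [lam D^2 <= 1] and the exponential is at most [1 + 3 lam D^2]; the
    conditional mean of [D^2] is [O(1 / n)], as all shares are at most [2 / n]. *)
Lemma Ex_expR_step_sqr_sum delta eta lam s : uniq s -> 0 <= delta <= 1 -> 0 <= lam ->
  lam * eta ^+ 2 <= 1 ->
  E (fun x => (tame delta eta x s)%:R * expR (lam * step_sqr_sum x s)) <=
  expR ((size s)%:R * (3 * lam / (p ^+ 2 * nR))).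
Proof.
move=> + d01 l0 le1; elim: s => [_|i s ih /= /andP[is_ us]].
  by rewrite mul0r expR0 (@eq_Ex _ _ _ _ (fun=> 1)) ?Ex_cst// => x /=;
    rewrite mul1r mulr0 expR0.
set K := _ / _ in ih *.
rewrite (@eq_Ex _ _ _ _ (fun x => ((tame delta eta x s && flat delta x s)%:R *
    expR (lam * step_sqr_sum x s)) * ((`|step x s i| <= eta)%R%:R * expR (lam * step x s i ^+ 2)))); last first.
  move=> x; rewrite mulrDr expRD andbA.
  by case: (tame _ _ _ _ && _); case: (_ <= eta); rewrite /= ?mul1r ?mul0r ?mulr0.
apply: (@le_trans _ _ (expR K * E (fun x => (tame delta eta x s && flat delta x s)%:R *
    expR (lam * step_sqr_sum x s)))).
  apply: (@Ex_cond_le _ _ _ (rows s)) => //.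
  - by move=> x y xy; rewrite (dep_tame _ _ xy) (dep_flat _ xy) (dep_step_sqr_sum xy).
  move=> x; case: (boolP (flat delta x s)) => [fl _|_]; last by rewrite andbF mul0r eqxx.
  pose L := lin p (row_coef i (fun j => avoid_share x s j / p)).
  apply: (@le_trans _ _ (E (fun y => 1 + 3 * lam * L y ^+ 2))).
    apply: le_Ex => // y; rewrite step_merge// -lin_row_coef -/(L y).
    case: (leP `|L y| eta) => [Le|_]; last first.
      by rewrite /= mul0r addr_ge0// mulr_ge0 ?sqr_ge0// mulr_ge0.
    rewrite /= mul1r -mulrA expR_le1D3// mulr_ge0 ?sqr_ge0//=.
    apply: le_trans le1; rewrite ler_wpM2l// -real_normK ?num_real//.
    by rewrite lerXn2r ?nnegrE// (le_trans _ Le).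
  rewrite ExD Ex_cst ExZ Ex_lin_sqr sum_row_coef_sqr.
  apply: le_trans (expR_ge1Dx _); rewrite lerD2l /K.
  apply: ler_wpM2l; first by rewrite mulr_ge0.
  apply: (@le_trans _ _ (4^-1 * \sum_(j < n) (2 / nR / p) ^+ 2)).
    have /andP[a0 a1] := p1p_le p01w.
    apply: ler_pM => //; first by rewrite sumr_ge0// => j _; rewrite sqr_ge0.
    apply: ler_sum => j _.
    have wp : 0 <= avoid_share x s j / p by exact: (divr_ge0 (avoid_share_ge0 _ _ _) (ltW p0)).
    have w2 : 0 <= 2 / nR / p by rewrite !divr_ge0// ltW.
    rewrite lerXn2r ?nnegrE//.
    by rewrite ler_wpM2r ?invr_ge0 ?(ltW p0)// (avoid_share_le _ d01).
  rewrite sumr_const card_ord -mulr_natr.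
  by apply: eq_lerW; field; rewrite !gt_eqF.
rewrite -[(size s).+1]addn1 natrD mulrDl mul1r expRD mulrC.
rewrite ler_wpM2r ?expR_ge0//; apply: le_trans (ih us).
apply: le_Ex => // x; rewrite ler_wpM2r ?expR_ge0//.
by case: tame; rewrite /= ?ler_nat ?leq_b1.
Qed.

Lemma Pr_step_sqr_sum delta eta lam s : uniq s -> 0 <= delta <= 1 -> 0 <= lam ->
  lam * eta ^+ 2 <= 1 ->
  PP (fun x => tame delta eta x s && (4 / p ^+ 2 < step_sqr_sum x s)) <=
  expR (- (lam / p ^+ 2)).
Proof.
move=> us d01 l0 le1.
have size_le : (size s)%:R <= nR.
  by rewrite ler_nat -[leqRHS]card_ord -(card_uniqP us) max_card.
apply: (@le_trans _ _ (E (fun x => expR (- (lam * (4 / p ^+ 2))) *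
      ((tame delta eta x s)%:R * expR (lam * step_sqr_sum x s))))).
  apply: markov_Pr => // x.
  move=> /andP[-> ux]; rewrite mul1r -expRD -[leLHS]expR0 ler_expR addrC subr_ge0.
  by rewrite ler_wpM2l// ltW.
rewrite ExZ.
apply: (@le_trans _ _ (expR (- (lam * (4 / p ^+ 2))) * expR (3 * lam / p ^+ 2))).
  rewrite ler_wpM2l ?expR_ge0//.
  apply: (le_trans (Ex_expR_step_sqr_sum us d01 l0 le1)).
  rewrite ler_expR.
  apply: (@le_trans _ _ (nR * (3 * lam / (p ^+ 2 * nR)))).
    apply: ler_wpM2r => //.
    by rewrite divr_ge0 ?mulr_ge0 ?sqr_ge0// ltW.
  by apply: eq_lerW; field; rewrite !gt_eqF.
rewrite -expRD ler_expR; apply: eq_lerW; field; by rewrite gt_eqF.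
Qed.

Lemma Pr_step delta eta t s i : uniq s -> i \notin s -> 0 <= delta <= 1 ->
  0 <= t -> t * 2 <= p * nR ->
  PP (fun x => flat delta x s && (eta < `|step x s i|)) <=
  2 * expR (t ^+ 2 * (4 / (p ^+ 2 * nR)) - t * eta).
Proof.
move=> us is_ d01 t0 tp; apply: (@Pr_cond_le _ _ _ (rows s)) => // x.
have [fl|nfl] := boolP (flat delta x s); last first.
  rewrite /Pr (@eq_Ex _ _ _ _ (fun=> 0)) ?Ex_cst ?mulr_ge0 ?expR_ge0// => y.
  by rewrite (dep_mergel _ _ (@dep_flat delta s)) (negbTE nfl).
have wb j : `|avoid_share x s j / p| <= 2 / nR / p.
  rewrite (ger0_norm (divr_ge0 (avoid_share_ge0 _ _ _) (ltW p0))).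
  by rewrite ler_wpM2r ?invr_ge0 ?(ltW p0)// (avoid_share_le _ d01).
have tl := @tail_abs_lin _ _ p p01w (row_coef i (fun j => avoid_share x s j / p)) t eta
  (t ^+ 2 * (4 / (p ^+ 2 * nR))) t0.
apply: le_trans (tl _ _).
- apply: Pr_le => // y /andP[_]; by rewrite step_merge// lin_row_coef.
- move=> ij; rewrite normrM (ger0_norm t0).
  apply: (@le_trans _ _ (t * (2 / nR / p))).
    rewrite ler_wpM2l// row_coef_le// !divr_ge0// ltW//.
  have -> : t * (2 / nR / p) = t * 2 / (p * nR) by field; rewrite !gt_eqF.
  by rewrite ler_pdivrMr ?mul1r// mulr_gt0.
- rewrite sum_row_coef_sqr ler_wpM2l ?sqr_ge0//.
  apply: (@le_trans _ _ (\sum_(j < n) (2 / nR / p) ^+ 2)).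
    apply: ler_sum => j _; rewrite -real_normK ?num_real//.
    by rewrite lerXn2r ?nnegrE// !divr_ge0// ltW.
  rewrite sumr_const card_ord -mulr_natr.
  by apply: eq_lerW; field; rewrite !gt_eqF.
Qed.

End RowProcess.

(** * The comparison fails with probability O(1/n^2) *)

Section GoodEvent.
Context {R : realType} {n : nat}.
Variable p : R.
Hypotheses (n0 : (0 < n)%N) (p01 : 0 < p < 1).
Implicit Types (x y : {ffun 'I_n * 'I_n -> bool}) (s : seq 'I_n) (i j : 'I_n).
Implicit Types delta eta lam t u d rho : R.

Notation E := (Ex (fun _ : 'I_n * 'I_n => p)).
Notation PP := (Pr (fun _ : 'I_n * 'I_n => p)).
Notation nR := (n%:R : R).

Let p0 : 0 < p. Proof. by case/andP: p01. Qed.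
Let p1 : p < 1. Proof. by case/andP: p01. Qed.
Let p01w : 0 <= p <= 1. Proof. by rewrite !ltW. Qed.
Let q01 : forall _ : 'I_n * 'I_n, 0 <= p <= 1. Proof. by []. Qed.
Let nR0 : 0 < nR. Proof. by rewrite ltr0n. Qed.

Definition cols_but2 j j' : seq 'I_n := del j (del j' (enum 'I_n)).

Lemma cols_but2_uniq j j' : uniq (cols_but2 j j').
Proof. by rewrite !del_uniq ?enum_uniq. Qed.

(** The degrees are large, but the linear form of column [j], with coefficients
    determined by the columns other than [j] and [j'], is far from its mean. *)
Definition unbalanced d rho s j j' x : bool :=
  all (fun i => d <= \sum_(c <- cols_but2 j j') adj x i c) s &&
  (rho * near_per (adj x) s (cols_but2 j j') <
   `|\sum_(i <- s) (adj x i j - p) * per (adj x) (del i s) (cols_but2 j j')|).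

(** Conditionally on the other columns, column [j] consists of fresh independent bits
    and the exponential bound for linear forms applies, with the norm of the
    coefficients estimated by [sum_per_del_sqr]. *)
Lemma Pr_unbalanced d rho s j j' : uniq s -> 0 < d -> 0 <= rho <= 2 ->
  PP (unbalanced d rho s j j') <= 2 * expR (- (rho ^+ 2 * d / 4)).
Proof.
move=> us d0 /andP[rho0 rho2].
(* [x] fixes all the columns but [j] *)
apply: (@Pr_cond_le _ _ _ (fun ij => ij.2 != j)) => // x.
have adjE y i c : c \in cols_but2 j j' ->
    adj (merge (fun ij : 'I_n * 'I_n => ij.2 != j) x y) i c = adj x i c :> R.
  by rewrite mem_del => /andP[cj _]; rewrite /adj ffunE cj.
pose Q : R := near_per (adj x) s (cols_but2 j j').
pose b i : R := per (adj x) (del i s) (cols_but2 j j').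
have bad2E y : unbalanced d rho s j j' (merge (fun ij : 'I_n * 'I_n => ij.2 != j) x y) =
    all (fun i => d <= \sum_(c <- cols_but2 j j') adj x i c) s &&
    (rho * Q < `|lin p (col_coef j s b) y|).
  rewrite /unbalanced; congr (_ && _).
    by apply: eq_all => i; congr (_ <= _); apply: eq_big_seq => c cC; rewrite adjE.
  set x' := merge _ x y.
  have perE s' : per (adj x') s' (cols_but2 j j') = per (adj x) s' (cols_but2 j j') :> R.
    by apply: per_ext => *; exact: adjE.
  have -> : near_per (adj x') s (cols_but2 j j') = Q.
    by rewrite /Q /near_per perE; congr (_ + _); apply: eq_bigr => i _; exact: perE.
  suff -> : \sum_(i <- s) (adj x' i j - p) * per (adj x') (del i s) (cols_but2 j j') =
            lin p (col_coef j s b) y by [].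
  rewrite lin_col_coef//; apply: eq_bigr => i _; rewrite mulrC perE.
  by rewrite /adj ffunE eqxx.
rewrite [Pr _ _](_ : _ = PP (fun y => all (fun i => d <= \sum_(c <- cols_but2 j j') adj x i c) s &&
    (rho * Q < `|lin p (col_coef j s b) y|))); last by apply: eq_Ex => y; rewrite bad2E.
have [/allP dg|_] := boolP (all _ s); last first.
  by rewrite /Pr (@eq_Ex _ _ _ _ (fun=> 0)) ?Ex_cst ?mulr_ge0 ?expR_ge0.
have a01 := @adj01 R n x.
have b0 i : 0 <= b i by exact: per_ge0 (adj_ge0 x).
have bQ i : i \in s -> b i <= Q / d.
  by move=> is_; apply: per_del_le => //; exact: cols_but2_uniq.
have Q0 : 0 <= Q by exact: near_per_ge0.
have bQ2 : \sum_(i <- s) b i ^+ 2 <= Q ^+ 2 / d.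
  by apply: sum_per_del_sqr => //; exact: cols_but2_uniq.
have [Qe|Qn] := eqVneq Q 0.
  rewrite /Pr (@eq_Ex _ _ _ _ (fun=> 0)) ?Ex_cst ?mulr_ge0 ?expR_ge0// => y /=.
  rewrite lin_col_coef// big1_seq ?normr0 ?Qe ?mulr0 ?ltxx// => i /andP[_ is_].
  by rewrite (@le_anti _ _ (b i) 0) ?mul0r// b0 (le_trans (bQ _ is_))// Qe mul0r.
have {}Q0 : 0 < Q by rewrite lt_neqAle eq_sym Qn.
(* the parameter [rho d / (2 Q)] minimises the exponent, since the squared norm of the
   coefficients is at most [Q^2 / d] *)
have -> : - (rho ^+ 2 * d / 4) = rho ^+ 2 * d / 4 - rho * d / (2 * Q) * (rho * Q).
  by field; rewrite gt_eqF.
have t0 : 0 <= rho * d / (2 * Q) by rewrite divr_ge0 ?mulr_ge0// ltW.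
apply: tail_abs_lin => //.
- move=> ij; rewrite normrM (ger0_norm t0).
  apply: (@le_trans _ _ (rho * d / (2 * Q) * (Q / d))).
    rewrite ler_wpM2l// /col_coef; case: ifP => [/andP[_ /bQ]|_].
      by rewrite ger0_norm.
    by rewrite normr0 divr_ge0// ltW.
  rewrite (_ : _ * _ = rho / 2); first by rewrite ler_pdivrMr// mul1r.
  by field; rewrite !gt_eqF.
- rewrite sum_col_coef_sqr//.
  apply: (@le_trans _ _ ((rho * d / (2 * Q)) ^+ 2 * (Q ^+ 2 / d))).
    by rewrite ler_wpM2l ?sqr_ge0.
  by apply: eq_lerW; field; rewrite !gt_eqF.
Qed.

(** The margin 2 pays for the two columns that are removed later. *)
Definition large_degrees d x : bool := [forall i, d + 2 <= \sum_j adj x i j].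

Lemma large_degrees_cols_but2 d x i j j' : large_degrees d x -> d <= \sum_(c <- cols_but2 j j') adj x i c.
Proof.
move=> /forallP/(_ i); rewrite -big_enum/=.
have del_le k (C : seq 'I_n) : uniq C ->
    \sum_(c <- C) adj x i c <= 1 + \sum_(c <- del k C) adj x i c :> R.
  move=> uC; have [kC|kC] := boolP (k \in C); last by rewrite del_id// lerDr.
  rewrite (bigD1_seq k)//= /del big_filter lerD2r.
  by have /andP[] := @adj01 R n x i k.
have h1 := del_le j' _ (enum_uniq 'I_n).
have h2 := del_le j _ (del_uniq j' (enum_uniq 'I_n)).
by rewrite /cols_but2; move: h1 h2; lra.
Qed.

(** Comparing every column with every other one compares it with the average. *)
Lemma flat_of_balanced d rho s x : uniq s -> 0 <= rho <= p / 2 -> large_degrees d x ->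
  (forall j j', j != j' -> ~~ unbalanced d rho s j j' x) -> flat (4 * rho / p) x s.
Proof.
move=> us rho01 dg nb.
have d0 : 0 <= 4 * rho / p.
  by case/andP: rho01 => r0 _; rewrite divr_ge0 ?mulr_ge0// ltW.
have key j j' : `|rowper_avoid x s j' - rowper_avoid x s j| <= 4 * rho / p * rowper_avoid x s j' :> R.
  have [->|jj'] := eqVneq j j'.
    by rewrite subrr normr0 mulr_ge0// rowper_avoid_ge0.
  have nbE k k' : k != k' ->
      `|\sum_(i <- s) (adj x i k - p) * per (adj x) (del i s) (cols_but2 k k')| <=
      rho * near_per (adj x) s (cols_but2 k k').
    move=> /nb; rewrite negb_and => /orP[/allPn[i _]|]; last by rewrite -leNgt.
    by rewrite large_degrees_cols_but2.
  apply: per_del_flat => //; rewrite ?enum_uniq ?mem_enum//.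
  - exact: adj01.
  - by rewrite p0 ltW.
  - exact: nbE.
  - by rewrite delC; apply: nbE; rewrite eq_sym.
apply/forallP => j.
have -> : rowper_avoid x s j - rowper_avoid_sum x s / nR = (\sum_j' (rowper_avoid x s j - rowper_avoid x s j')) / nR.
  rewrite sumrB sumr_const card_ord -mulr_natr -/(rowper_avoid_sum x s).
  by field; rewrite gt_eqF.
rewrite normrM (ger0_norm (x := nR^-1)) ?invr_ge0 ?(ltW nR0)// mulrA.
rewrite ler_wpM2r ?invr_ge0 ?(ltW nR0)//.
apply: (le_trans (ler_norm_sum _ _ _)); rewrite /rowper_avoid_sum big_distrr/=.
by apply: ler_sum => j' _; rewrite distrC.
Qed.

Lemma Pr_notflat d rho s : uniq s -> 0 < d -> 0 <= rho <= p / 2 ->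
  PP (fun x => large_degrees d x && ~~ flat (4 * rho / p) x s) <=
  nR ^+ 2 * (2 * expR (- (rho ^+ 2 * d / 4))).
Proof.
move=> us d0 rho01.
have rho2 : 0 <= rho <= 2.
  by case/andP: rho01 => -> /= h; rewrite (le_trans h)//; have := p1; lra.
apply: (@le_trans _ _ (PP (fun x =>
    has (fun jj => unbalanced d rho s jj.1 jj.2 x) (enum {: 'I_n * 'I_n})))).
  apply: Pr_le => // x /andP[dg nf]; apply/hasP.
  suff [jj] : exists jj, unbalanced d rho s jj.1 jj.2 x.
    by exists jj => //; rewrite mem_enum.
  apply: contrapT => nb; move/negP: nf; apply.
  apply: flat_of_balanced dg _ => // j j' _; apply/negP => b.
  by apply: nb; exists (j, j').
apply: (le_trans (Pr_has _ _ _)) => //.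
apply: (@le_trans _ _ (\sum_(jj <- enum {: 'I_n * 'I_n})
    (2 * expR (- (rho ^+ 2 * d / 4))))).
  by apply: ler_sum => jj _; exact: Pr_unbalanced.
by rewrite big_enum/= sumr_const card_prod card_ord -(mulr_natl (2 * _)) natrM expr2.
Qed.

Lemma Pr_nottame d rho eta t s : uniq s -> 0 < d -> 0 <= rho <= p / 2 ->
  4 * rho / p <= 1 -> 0 <= t -> t * 2 <= p * nR ->
  PP (fun x => large_degrees d x && ~~ tame p (4 * rho / p) eta x s) <=
  (size s)%:R * (nR ^+ 2 * (2 * expR (- (rho ^+ 2 * d / 4))) +
    2 * expR (t ^+ 2 * (4 / (p ^+ 2 * nR)) - t * eta)).
Proof.
move=> + d0 rho01 de1 t0 tp; set delta := 4 * rho / p in de1 *.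
have d01 : 0 <= delta <= 1.
  by rewrite de1 andbT; case/andP: rho01 => r0 _; rewrite divr_ge0 ?mulr_ge0// ltW.
elim: s => [_|i s ih /= /andP[is_ us]].
  by rewrite mul0r /Pr (@eq_Ex _ _ _ _ (fun=> 0)) ?Ex_cst// => x; rewrite andbF.
set K := _ + _ in ih *.
apply: (@le_trans _ _ (PP (fun x => (large_degrees d x && ~~ tame p delta eta x s) ||
   ((large_degrees d x && ~~ flat delta x s) ||
    (flat delta x s && (eta < `|step p x s i|)))))).
  apply: Pr_le => // x; rewrite ltNge.
  by case: (large_degrees d x); case: (tame _ _ _ _ _); case: flat; case: (_ <= _).
rewrite -[(size s).+1]addn1 natrD mulrDl mul1r.
apply: (le_trans (Pr_or _ _ _)) => //; apply: lerD; first exact: ih.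
apply: (le_trans (Pr_or _ _ _)) => //; apply: lerD; first exact: Pr_notflat.
exact: Pr_step.
Qed.

Lemma tame_all_flat delta eta x s : tame p delta eta x s -> all_flat delta x s.
Proof. by elim: s => //= i s ih /and3P[/ih -> ->]. Qed.

Lemma Pr_not_large_degrees d : d + 2 <= p * nR / 2 ->
  PP (fun x => ~~ large_degrees d x) <= nR * expR (- (p ^+ 2 * nR / 16)).
Proof.
move=> dle.
apply: (@le_trans _ _ (PP (fun x =>
    has (fun i => p * nR / 2 < lin p (row_coef i (fun=> -1)) x) (enum 'I_n)))).
  apply: Pr_le => // x /forallPn[i]; rewrite -ltNge => lt_d.
  apply/hasP; exists i; first by rewrite mem_enum.
  rewrite lin_row_coef -big_distrr/= sumrB sumr_const card_ord -mulr_natr.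
  by move: lt_d dle; rewrite /adj; lra.
apply: (le_trans (Pr_has _ _ _)) => //.
apply: (@le_trans _ _ (\sum_(i <- enum 'I_n) expR (- (p ^+ 2 * nR / 16)))).
  apply: ler_sum => i _.
  have -> : - (p ^+ 2 * nR / 16) = (p / 4) ^+ 2 * nR - p / 4 * (p * nR / 2) by field.
  have p40 : 0 <= p / 4 by rewrite divr_ge0// ltW.
  apply: tail_lin => //.
  - move=> ij; rewrite normrM (ger0_norm p40) mulr_ile1//.
      by have := p1; lra.
    by rewrite row_coef_le// => j; rewrite normrN normr1.
  - rewrite sum_row_coef_sqr (eq_bigr (fun=> 1)) ?sumr_const ?card_ord// => j _.
    by rewrite sqrrN expr1n.
by rewrite big_enum/= sumr_const card_ord mulr_natl.
Qed.

(** Summing [D - D^2 <= ln (1 + D) <= D] over the rows; the main parts of the [D]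
    sum to the edge surplus over [n p]. *)
Lemma tame_ln_rowper delta eta x s : uniq s -> eta <= 2^-1 -> tame p delta eta x s ->
  0 < rowper x s :> R /\
  `|ln (rowper x s) - ln ((n ^_ (size s))%:R * p ^+ size s) -
    (\sum_(i <- s) rowdev p x i) / (nR * p) - cstep_sum p x s| <= step_sqr_sum p x s.
Proof.
move=> + e2; elim: s => [_ _|i s ih /= /andP[is_ us] /and3P[gs _ De]].
  by rewrite /rowper/= ffactn0 mul1r expr0 ln1 big_nil mul0r !subr0 normr0.
have [P0 Hs] := ih us gs.
have size_lt : (size s < n)%N.
  have := uniq_leq_size (s1 := i :: s) (s2 := enum 'I_n).
  rewrite size_enum_ord /= is_ us; apply => // k _; by rewrite mem_enum.
have m0 : 0 < nR - (size s)%:R by rewrite subr_gt0 ltr_nat.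
have T0 : 0 < rowper_avoid_sum x s :> R by rewrite rowper_avoid_sumE mulr_gt0.
have D2 : `|step p x s i| <= 2^-1 by exact: le_trans De e2.
have D1 : 0 < 1 + step p x s i.
  by move: D2; rewrite ler_norml => /andP[h _]; lra.
have Dl := ln1D_ge_quad D2.
have Du : ln (1 + step p x s i) <= step p x s i by apply: le_ln1Dx; lra.
rewrite (rowper_step p01 i T0); split; first by rewrite !mulr_gt0.
have f0 : 0 < (n ^_ (size s))%:R * p ^+ size s :> R.
  by rewrite mulr_gt0 ?exprn_gt0// ltr0n ffact_gt0 ltnW.
have -> : (n ^_ (size s).+1)%:R * p ^+ (size s).+1 =
    (nR - (size s)%:R) * p * ((n ^_ (size s))%:R * p ^+ size s).
  by rewrite ffactnSr natrM natrB 1?ltnW// exprS; ring.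
move: f0 Hs; generalize ((n ^_ size s)%:R * p ^+ size s) => f f0 Hs.
rewrite !(lnM, posrE) ?mulr_gt0//.
have Ds := step_split n0 p01 i T0.
have D20 := sqr_ge0 (step p x s i).
rewrite big_cons mulrDl.
move: Hs; rewrite !ler_norml => /andP[h1 h2].
move: Dl Du h1 h2 Ds D20; set L := ln (1 + _); set ip := rowdev _ _ _ / _ => *.
by apply/andP; split; lra.
Qed.

Definition typical x : bool :=
  (0 < rowper x (enum 'I_n) :> R) &&
  (`|ln (rowper x (enum 'I_n)) - ln ((n `!)%:R * p ^+ n) -
     (\sum_i rowdev p x i) / (nR * p)| <= 1 + 4 / p ^+ 2).

(** With [r] the eighth root of [n], all the parameters are powers of [r]. *)
Lemma Pr_not_typical_root (r : R) : r ^+ 8 = nR -> 16 / p ^+ 2 <= r ->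
  PP (fun x => ~~ typical x) <= 16 * r ^+ 24 * expR (- r).
Proof.
move=> rn rp.
have p2 : p ^+ 2 <= p by rewrite expr2 ler_piMl// ltW.
have p20 : 0 < p ^+ 2 by rewrite exprn_gt0.
have rp2 : 16 <= p ^+ 2 * r by rewrite mulrC -ler_pdivrMr.
have r16 : 16 <= r.
  apply: le_trans rp2 _; rewrite ler_piMl//.
    by apply: le_trans rp; rewrite divr_ge0// ltW.
  by rewrite (le_trans p2)// ltW.
have r0 : 0 < r by lra.
have rp1 : 16 <= p * r by rewrite (le_trans rp2)// ler_wpM2r// ltW.
have up k : r <= r ^+ k.+1.
  by rewrite exprS ler_peMr ?(ltW r0)// exprn_ege1//; lra.
have pup k : 16 <= p * r ^+ k.+1 by rewrite (le_trans rp1)// ler_wpM2l ?(ltW p0).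
have p2up k : 16 <= p ^+ 2 * r ^+ k.+1.
  by rewrite (le_trans rp2)// ler_wpM2l// ltW.
(* With these values [rho^2 d] is of order [r^4], the exponential moments of orders [r]
   and [r^2] are bounded, and every failure probability is at most a power of [r]
   times [exp (- r)]. *)
pose rho := r ^- 2; pose d := p * nR / 4; pose eta := r^-1.
pose delta := 4 * rho / p.
have d0 : 0 < d by rewrite divr_gt0// mulr_gt0.
have rho01 : 0 <= rho <= p / 2.
  rewrite invr_ge0 exprn_ge0 ?(ltW r0)//= /rho.
  rewrite -[leLHS]div1r ler_pdivrMr ?exprn_gt0// mulrAC.
  by have := pup 1%N; lra.
have de1 : delta <= 1.
  rewrite /delta /rho ler_pdivrMr// mul1r ler_pdivrMr ?exprn_gt0//.
  by have := pup 1%N; lra.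
have de0 : 0 <= delta.
  by case/andP: rho01 => h _; rewrite divr_ge0 ?mulr_ge0// ltW.
have e2 : eta <= 2^-1 by rewrite lef_pV2 ?posrE//; lra.
have tp : r ^+ 2 * 2 <= p * nR.
  rewrite -rn (_ : p * r ^+ 8 = r ^+ 2 * (p * r ^+ 6)); last by ring.
  by rewrite ler_wpM2l ?sqr_ge0//; have := pup 5; lra.
have us := enum_uniq 'I_n.
have dle : d + 2 <= p * nR / 2.
  by rewrite /d -rn; have := pup 7; lra.
have lamd : r * delta <= p.
  rewrite (_ : r * delta = 4 / (p * r)); last by rewrite /delta /rho; field; rewrite !gt_eqF.
  rewrite ler_pdivrMr ?mulr_gt0// mulrA -expr2; lra.
have lame : r ^+ 2 * eta ^+ 2 <= 1 by rewrite /eta -exprMn divff ?expr1n// gt_eqF.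
pose G x := [&& large_degrees d x, tame p delta eta x (enum 'I_n),
  `|cstep_sum p x (enum 'I_n)| <= 1 & step_sqr_sum p x (enum 'I_n) <= 4 / p ^+ 2].
have Gok x : G x -> typical x.
  move=> /and4P[_ gx Cx Dx].
  have [P0 H] := tame_ln_rowper us e2 gx.
  rewrite /typical P0 /=.
  move: H; rewrite size_enum_ord ffactnn big_enum/=.
  set L := ln _ - ln _ - _ => H.
  apply: le_trans (_ : `|L - cstep_sum p x (enum 'I_n)| + `|cstep_sum p x (enum 'I_n)| <= _).
    by rewrite -[X in `|X| <= _](subrK (cstep_sum p x (enum 'I_n))) ler_normD.
  by rewrite addrC lerD// (le_trans H).
apply: (@le_trans _ _ (PP (fun x => ~~ large_degrees d x ||
  ((large_degrees d x && ~~ tame p delta eta x (enum 'I_n)) ||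
  ((all_flat delta x (enum 'I_n) && (1 < `|cstep_sum p x (enum 'I_n)|)) ||
   (tame p delta eta x (enum 'I_n) && (4 / p ^+ 2 < step_sqr_sum p x (enum 'I_n)))))))).
  apply: Pr_le => // x; apply: contraNT; rewrite !negb_or !negb_and !negbK -!leNgt.
  case/and4P => dg; rewrite dg /= => gx; rewrite gx (tame_all_flat gx) /= => Cx Dx.
  by apply: Gok; rewrite /G dg gx Cx Dx.
have b1 := Pr_not_large_degrees dle.
have b2 := Pr_nottame eta us d0 rho01 de1 (sqr_ge0 r) tp.
have b3 := Pr_cstep_sum n0 p01 1 us de0 (ltW r0) lamd.
have b4 : PP (fun x => tame p delta eta x (enum 'I_n) &&
    (4 / p ^+ 2 < step_sqr_sum p x (enum 'I_n))) <= expR (- (r ^+ 2 / p ^+ 2)).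
  by apply: Pr_step_sqr_sum => //; [rewrite de0|exact: sqr_ge0].
have er0 := expR_gt0 (- r).
have c1 : expR (- (p ^+ 2 * nR / 16)) <= expR (- r).
  rewrite ler_expR lerN2 -rn.
  rewrite (_ : p ^+ 2 * r ^+ 8 / 16 = r * (p ^+ 2 * r ^+ 7 / 16)); last by field.
  by rewrite ler_peMr ?(ltW r0)//; have := p2up 6; lra.
have c2 : expR (- (rho ^+ 2 * d / 4)) <= expR (- r).
  rewrite ler_expR lerN2 /rho /d -rn.
  rewrite (_ : _ / 4 = r * (p * r ^+ 3 / 16)); last by field; rewrite gt_eqF.
  by rewrite ler_peMr ?(ltW r0)//; have := pup 2; lra.
have e3 : expR 1 <= 4 :> R.
  have := @expR_le1D3 R 1; rewrite ler01 lexx => /(_ isT); lra.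
have c3 : expR ((r ^+ 2) ^+ 2 * (4 / (p ^+ 2 * nR)) - r ^+ 2 * eta) <= 4 * expR (- r).
  apply: (@le_trans _ _ (expR (1 - r))).
    rewrite ler_expR (_ : r ^+ 2 * eta = r); last by rewrite /eta; field; rewrite gt_eqF.
    rewrite lerD2r -rn [leLHS](_ : _ = 4 / (p ^+ 2 * r ^+ 4)); last by field; rewrite !gt_eqF.
    by rewrite ler_pdivrMr ?mulr_gt0 ?exprn_gt0// mul1r; have := p2up 3; lra.
  by rewrite expRD ler_wpM2r// ltW.
have c4 : expR (1 - r * 1) <= 4 * expR (- r).
  by rewrite mulr1 expRD ler_wpM2r// ltW.
have c5 : expR (- (r ^+ 2 / p ^+ 2)) <= expR (- r).
  rewrite ler_expR lerN2 ler_pdivlMr// (le_trans _ (up 1%N))//.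
  by rewrite ler_piMr ?(ltW r0)// (le_trans p2)// ltW.
rewrite size_enum_ord in b2.
have r1 : 1 <= r ^+ 8 by rewrite exprn_ege1//; lra.
apply: (le_trans (Pr_or _ _ _)) => //.
apply: (@le_trans _ _ (r ^+ 8 * expR (- r) + (r ^+ 8 * (r ^+ 16 * (2 * expR (- r)) +
   2 * (4 * expR (- r))) + (2 * (4 * expR (- r)) + expR (- r))))).
  apply: lerD.
    apply: (le_trans b1); rewrite -rn ler_wpM2l// ?exprn_ge0 ?(ltW r0)//.
    by rewrite rn.
  apply: (le_trans (Pr_or _ _ _)) => //; apply: lerD.
    apply: (le_trans b2).
    rewrite -{1 2}rn -exprM ler_wpM2l ?exprn_ge0 ?(ltW r0)//.
    apply: lerD; last by rewrite ler_wpM2l.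
    by rewrite ler_wpM2l ?exprn_ge0 ?(ltW r0)// ler_wpM2l.
  apply: (le_trans (Pr_or _ _ _)) => //; apply: lerD; last exact: le_trans b4 c5.
  by apply: (le_trans b3); rewrite ler_wpM2l.
set e := expR (- r) in er0 *.
rewrite [leLHS](_ : _ = (r ^+ 8 + r ^+ 8 * r ^+ 16 * 2 + r ^+ 8 * 8 + 9) * e); last by ring.
rewrite ler_wpM2r ?(ltW er0)//.
rewrite (_ : r ^+ 24 = r ^+ 8 * (r ^+ 8 * r ^+ 8)) 1?(_ : r ^+ 16 = r ^+ 8 * r ^+ 8); [|by ring|by ring].
have h16 : 16 <= r ^+ 8 by exact: le_trans r16 (up 7).
move: (r ^+ 8) h16 => z z16.
have z2 : 16 * z <= z * z by rewrite ler_wpM2r//; lra.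
have z3 : 16 * (z * z) <= z * (z * z) by rewrite ler_wpM2r//; nra.
by rewrite -!mulrA; nra.
Qed.

End GoodEvent.

Lemma pow_le_expR {R : realType} (k : nat) :
  exists2 F : R, 0 < F & forall x, 0 <= x -> x ^+ k.+1 <= F * expR x.
Proof.
have F0 : 0 < (k.+1)`!%:R :> R by rewrite ltr0n fact_gt0.
exists (k.+1)`!%:R => // x x0.
rewrite -ler_pdivrMl// mulrC.
by apply: le_trans (expR_ge1Dxn k x0); rewrite lerDr.
Qed.

(** The bound by [exp (- n^(1/8))] times a power of [n] is far below [n^(-2)]. *)
Lemma Pr_not_typical {R : realType} (p : R) : 0 < p < 1 ->
  exists2 K : R, 0 < K & \forall n \near \oo,
    Pr (fun _ : 'I_n * 'I_n => p) (fun x => ~~ typical p x) <= K / n%:R ^+ 2.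
Proof.
move=> p01; have [F F0 HF] := @pow_le_expR R 39.
exists (16 * F); first by rewrite mulr_gt0.
near=> n.
have n0 : (0 < n)%N by near: n; exact: nbhs_infty_gt.
pose r : R := Num.sqrt (Num.sqrt (Num.sqrt n%:R)).
have rn : r ^+ 8 = n%:R.
  by rewrite (exprM _ 4 2)%N (exprM _ 2 2)%N !sqr_sqrtr ?sqrtr_ge0.
have r0 : 0 < r by rewrite !sqrtr_gt0 ltr0n.
have rp : 16 / p ^+ 2 <= r.
  have q0 : 0 <= 16 / p ^+ 2 by rewrite divr_ge0// sqr_ge0.
  rewrite -(@ler_pXn2r _ 8) ?nnegrE// ?(ltW r0)// rn.
  near: n; exact: nbhs_infty_ger.
apply: (le_trans (Pr_not_typical_root n0 p01 rn rp)).
rewrite -rn ler_pdivlMr ?exprn_gt0// expRN.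
rewrite [leLHS](_ : _ = 16 * (r ^+ 40 / expR r)); last first.
  by field; rewrite gt_eqF ?expR_gt0.
by rewrite ler_wpM2l// ler_pdivrMr ?expR_gt0// HF// ltW.
Unshelve. all: by end_near. Qed.

(** * Perfect matchings are counted by the permanent *)

Section PermanentMatchings.
Context {R : realType} {U V : finType}.
Implicit Types (a : U -> V -> R) (s : seq U) (C : seq V) (f g : {ffun U -> V}).

Definition upd f r c : {ffun U -> V} := [ffun i => if i == r then c else f i].

(** Injective choices on [s] encoded as functions on all of [U]: outside [s] they take
    the default value [v0], so that each choice is represented once. *)
Definition selection (v0 : V) s C f : bool :=
  [&& all (fun i => f i \in C) s, uniq (map f s) & [forall i, (i \in s) || (f i == v0)]].

Lemma selection_upd v0 s C f r c : r \notin s -> c \in C ->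
  selection v0 (r :: s) C (upd f r c) && (upd (upd f r c) r v0 == f) =
  selection v0 s (del c C) f.
Proof.
move=> rs cC.
have ne i : i \in s -> (i == r) = false by move=> is_; apply: contraNF rs => /eqP <-.
have updE i : i \in s -> upd f r c i = f i by move=> /ne ir; rewrite ffunE ir.
have mapE : map (upd f r c) s = map f s by apply/eq_in_map.
rewrite /selection /= mapE ffunE eqxx cC /=.
have -> : all (fun i => f i \in del c C) s =
    all (fun i => upd f r c i \in C) s && (c \notin map f s).
  apply/allP/andP => [h|[/allP h1 h2] i is_].
    split; first by apply/allP => i is_; have := h i is_; rewrite mem_del updE// => /andP[].
    by apply/mapP => -[i is_ ce]; have := h i is_; rewrite mem_del ce eqxx.
  rewrite mem_del -(updE i is_) h1// andbT updE//.
  by apply: contraNneq h2 => <-; exact: map_f.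
rewrite -!andbA; congr (_ && _); congr (_ && _); congr (_ && _).
apply/andP/forallP => [[/forallP h /eqP e] i|h].
  rewrite -e !ffunE; have := h i; rewrite in_cons ffunE.
  by case: (eqVneq i r) => //= _ _; rewrite eqxx orbT.
split; first (apply/forallP => i; rewrite in_cons ffunE; case: eqP => //= _; exact: h).
apply/eqP/ffunP => i; rewrite !ffunE; case: eqP => // ->.
by have := h r; rewrite (negbTE rs) => /eqP.
Qed.

(** A choice for [r :: s] is a column for [r] together with a choice for [s] that avoids
    it. *)
Lemma per_selection v0 a s C : uniq s -> uniq C ->
  per a s C = \sum_(f | selection v0 s C f) \prod_(i <- s) a i (f i).
Proof.
elim: s C => [|r s ih] C /=.
  move=> _ _; rewrite (big_pred1 [ffun=> v0]) ?big_nil// => f.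
  rewrite /selection/=; apply/forallP/eqP => [h|-> i]; last by rewrite ffunE.
  by apply/ffunP => i; rewrite ffunE; exact/eqP/h.
move=> /andP[rs us] uC.
rewrite (partition_big (fun f : {ffun U -> V} => f r) (fun c => c \in C))/=; last first.
  by move=> f /and3P[/= /andP[]].
rewrite -big_uniq//=; apply: eq_big_seq => c cC.
rewrite (ih _ us (del_uniq c uC)) big_distrr/=.
rewrite [RHS](reindex_onto (fun f => upd f r c) (fun f => upd f r v0))/=; last first.
  move=> f /andP[_ /eqP fr]; apply/ffunP => i; rewrite !ffunE.
  by case: eqP => // ->.
apply: eq_big => [f|f _].
  by rewrite -(selection_upd v0 f rs cC) [upd f r c r]ffunE !eqxx andbT.
rewrite big_cons ffunE eqxx; congr (_ * _).
apply: eq_big_seq => i is_; rewrite ffunE.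
by case: eqP rs => // <-; rewrite is_.
Qed.

End PermanentMatchings.

Section CountMatchings.
Context {R : realType} {T : finType}.
Variable e : T -> T -> bool.

Definition graph (f : {ffun T -> T}) : {set T * T} := [set m | f m.1 == m.2]%SET.

Lemma graph_inj : injective graph.
Proof.
move=> f g fg; apply/ffunP => i.
by have := finset.in_set (fun m => f m.1 == m.2) (i, g i); rewrite -/(graph f) fg
  finset.in_set/= eqxx => /esym/eqP.
Qed.

Lemma perfect_matching_graph (f : {ffun T -> T}) : injective f -> (forall i, e i (f i)) ->
  perfect_matching e (graph f).
Proof.
move=> fi ef; apply/and3P; split.
- by apply/forallP => -[i j]; apply/implyP; rewrite finset.in_set /= => /eqP <-.
- apply/forallP => i; apply/cards1P; exists (i, f i); apply/setP => -[k l].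
  rewrite !(finset.in_set, finset.in_set1) /= xpair_eqE.
  by case: (eqVneq k i) => [->|_] /=; rewrite ?andbF// andbT eq_sym.
- apply/forallP => j.
  have fK := f_invF fi j.
  apply/cards1P; exists (invF fi j, j); apply/setP => -[k l].
  rewrite !(finset.in_set, finset.in_set1) /= xpair_eqE.
  case: (eqVneq l j) => [->|_] /=; rewrite ?andbF// !andbT.
  by rewrite -[X in _ == X](f_invF fi j) (inj_eq fi).
Qed.

(** The partner of every row is unique, and so is that of every column, which gives
    injectivity. *)
Lemma perfect_matching_is_graph M : perfect_matching e M ->
  exists2 f : {ffun T -> T}, injective f /\ (forall i, e i (f i)) & M = graph f.
Proof.
case/and3P => /forallP Me /forallP Mr /forallP Mc.
have row i : exists j, forall k, ((i, k) \in M) = (k == j).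
  have /cards1P[[i' j] H] := Mr i.
  have := finset.in_set1 (i', j) (i', j); rewrite -H finset.in_set eqxx /=.
  move=> /andP[_ /eqP ii]; subst i'; exists j => k.
  have := finset.in_set1 (i, k) (i, j); rewrite -H finset.in_set/= eqxx andbT.
  by rewrite xpair_eqE eqxx.
have [f Hf] := boolp.choice row.
have col i k j : (i, j) \in M -> (k, j) \in M -> i = k.
  have /cards1P[m H] := Mc j.
  move=> ij kj; have : (i, j) \in [set m]%SET by rewrite -H finset.in_set ij /=.
  have : (k, j) \in [set m]%SET by rewrite -H finset.in_set kj /=.
  by rewrite !finset.in_set1 => /eqP <- /eqP[].
exists [ffun i => f i].
  split=> [i k|i].
    by rewrite !ffunE => fik; apply: (col i k (f i)); rewrite Hf ?fik.
  have := Me (i, f i); rewrite Hf eqxx /= ffunE; exact.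
apply/setP => -[i j]; rewrite finset.in_set /= ffunE Hf eq_sym.
by [].
Qed.

Lemma nb_perfect_matchings_per : (0 < #|T|)%N ->
  (nb_perfect_matchings e)%:R =
  per (fun i j => (e i j)%:R : R) (enum T) (enum T).
Proof.
move=> /card_gt0P[v0 _].
rewrite (per_selection v0) ?enum_uniq//.
have -> : nb_perfect_matchings e =
    #|[set f : {ffun T -> T} | injectiveb f && [forall i, e i (f i)]]%SET|.
  rewrite -(card_imset _ graph_inj); apply: eq_card => M.
  rewrite finset.in_set; apply/idP/imsetP => [|[f]].
    move=> /perfect_matching_is_graph[f [fi ef] ->]; exists f => //.
    by rewrite finset.in_set; apply/andP; split; [apply/injectiveP|apply/forallP].
  rewrite finset.in_set => /andP[/injectiveP fi /forallP ef] ->.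
  exact: perfect_matching_graph.
rewrite -sum1_card natr_sum big_mkcond [RHS]big_mkcond/=.
apply: eq_bigr => f _; rewrite finset.in_set.
have -> : selection v0 (enum T) (enum T) f = injectiveb f.
  rewrite /selection /injectiveb /dinjectiveb.
  rewrite (_ : all _ _ = true) /=; last by apply/allP => i _; rewrite mem_enum.
  by rewrite (_ : [forall i, _] = true) ?andbT//; apply/forallP => i; rewrite mem_enum.
case: injectiveb => //=.
case: (boolP [forall i, _]) => [/forallP ef|/forallPn[i nei]].
  by rewrite big1// => i _; rewrite ef.
by rewrite (bigD1_seq i) ?mem_enum ?enum_uniq//= (negbTE nei) mul0r.
Qed.

End CountMatchings.

(** * From the probability space to finite configurations *)

Section Transfer.
Context {R : realType} {d : measure_display} {T : measurableType d}.
Variables (P : probability T R) (p : R).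
Variable G : nat * nat -> {RV P >-> bool}.
Hypothesis hG : random_bipartite_graph p G.

Definition cell {n} (ij : 'I_n * 'I_n) : nat * nat := (ij.1 : nat, ij.2 : nat).

Lemma cell_inj n : injective (@cell n).
Proof. by move=> [i j] [k l] [/val_inj -> /val_inj ->]. Qed.

Definition restr n (t : T) : {ffun 'I_n * 'I_n -> bool} :=
  [ffun ij => G (cell ij) t].

Lemma measurable_edge k (A : set bool) : measurable (G k @^-1` A).
Proof.
rewrite -[X in measurable X]setTI; apply: (measurable_funPT (G k)) => //.
Qed.

Lemma edge_prob k b : P (G k @^-1` [set b]) = (if b then p else 1 - p)%:E.
Proof.
have [_ Gp] := hG; case: b; first exact: Gp.
have -> : G k @^-1` [set false] = ~` (G k @^-1` [set true]).
  by apply/seteqP; split=> t /=; case: (G k t).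
by rewrite probability_setC ?Gp//; exact: measurable_edge.
Qed.

Lemma restr_prob1 n x :
  measurable [set t | restr n t = x] /\
  P [set t | restr n t = x] = (weight (fun=> p) x)%:E.
Proof.
pose J := [fset k in map cell (enum {: 'I_n * 'I_n})]%fset.
pose A k : set bool := [set b | forall ij : 'I_n * 'I_n, cell ij = k -> b = x ij].
have AE ij : A (cell ij) = [set x ij].
  by apply/seteqP; split=> b /=; [apply|move=> -> kl /cell_inj ->].
have E : [set t | restr n t = x] = \bigcap_(k in [set` J]) (G k @^-1` A k).
  apply/seteqP; split=> t /=.
    move=> tx k /=; rewrite !inE => /mapP[ij _ ->].
    by rewrite AE/= -tx ffunE.
  move=> h; apply/ffunP => ij; rewrite ffunE.
  have /(_ _) := h (cell ij); rewrite AE /=; apply.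
  by rewrite !inE; apply: map_f; rewrite mem_enum.
split.
  rewrite E; apply: fin_bigcap_measurable; first exact: finite_fset.
  by move=> k _; exact: measurable_edge.
have [Gi _] := hG; rewrite E Gi//.
rewrite (perm_big (map cell (enum {: 'I_n * 'I_n}))); last first.
  apply: uniq_perm; first exact: fset_uniq.
    by rewrite map_inj_uniq ?enum_uniq//; exact: cell_inj.
  by move=> k; rewrite !inE.
rewrite big_map big_enum/= /weight -prodEFin.
by apply: eq_bigr => ij _; rewrite AE edge_prob.
Qed.

Lemma restr_probs n (l : seq {ffun 'I_n * 'I_n -> bool}) : uniq l ->
  measurable [set t | restr n t \in l] /\
  P [set t | restr n t \in l] = (\sum_(x <- l) weight (fun=> p) x)%:E.
Proof.
elim: l => [_|x l ih /= /andP[xl ul]].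
  have -> : [set t | restr n t \in [::]] = set0 by apply/seteqP; split.
  by rewrite measure0 big_nil.
have [mx Px] := restr_prob1 x; have [ml Pl] := ih ul.
have -> : [set t | restr n t \in x :: l] =
    [set t | restr n t = x] `|` [set t | restr n t \in l].
  apply/seteqP; split=> t /=; rewrite in_cons.
    by case/orP => [/eqP|]; [left|right].
  by case=> [->|->]; rewrite ?eqxx ?orbT.
split; first exact: measurableU.
rewrite measureU//; last first.
  by apply/seteqP; split=> t //= -[-> xl']; rewrite xl' in xl.
by rewrite big_cons EFinD -Px -Pl.
Qed.

(** Mutual independence gives the probability of one configuration; an event that
    depends on the finite subgraph is a finite disjoint union of those. *)
Lemma restr_prob n (Q : {ffun 'I_n * 'I_n -> bool} -> bool) :
  measurable [set t | Q (restr n t)] /\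
  P [set t | Q (restr n t)] = (Pr (fun=> p) Q)%:E.
Proof.
have [m e] := restr_probs (filter_uniq Q (enum_uniq {: {ffun 'I_n * 'I_n -> bool}})).
have E : [set t | Q (restr n t)] =
  [set t | restr n t \in [seq x <- enum {: {ffun 'I_n * 'I_n -> bool}} | Q x]].
  by apply/seteqP; split=> t /=; rewrite mem_filter mem_enum andbT.
rewrite E; split => //; rewrite e big_filter big_enum_cond/=; congr EFin.
rewrite /Pr /Ex big_mkcond; apply: eq_bigr => x _.
by case: (Q x); rewrite ?mulr1 ?mulr0.
Qed.

Lemma measurable_restr n (Q : set {ffun 'I_n * 'I_n -> bool}) :
  measurable [set t | Q (restr n t)].
Proof.
have [m _] := @restr_prob n (fun x => `[< Q x >]).
by rewrite (_ : [set t | _] = [set t | `[< Q (restr n t) >]])//;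
  apply/seteqP; split=> t /= /asboolP.
Qed.

Lemma X_rowper n t : (0 < n)%N -> (X G n t)%:R = rowper (restr n t) (enum 'I_n) :> R.
Proof.
move=> n0; rewrite /X nb_perfect_matchings_per ?card_ord//.
by apply: per_ext => i j _ _; rewrite /adj ffunE.
Qed.

(** Every function of a finite subgraph takes finitely many values on measurable sets,
    whatever the target. *)
Lemma measurable_fun_restr n d' (T' : measurableType d') (f : T -> T')
  (g : {ffun 'I_n * 'I_n -> bool} -> T') : (forall t, f t = g (restr n t)) ->
  measurable_fun setT f.
Proof.
move=> fg _ B mB; rewrite setTI.
rewrite (_ : f @^-1` B = [set t | B (g (restr n t))]); first exact: (measurable_restr (g @^-1` B)).
by apply/seteqP; split=> t /=; rewrite fg.
Qed.

Lemma X_restr n t t' : restr n t = restr n t' -> X G n t = X G n t'.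
Proof.
move=> tt'; rewrite /X; congr nb_perfect_matchings; apply/funext => i; apply/funext => j.
by have /ffunP/(_ (i, j)) := tt'; rewrite !ffunE.
Qed.

End Transfer.

(** * Maximal inequality and independent shells *)

(** At most one index is the first at which [b] holds. *)
Lemma sum_first (b : nat -> bool) M :
  (\sum_(k < M) (b k && ~~ has b (iota 0 k)))%N = has b (iota 0 M).
Proof.
elim: M => [|M ih]; first by rewrite big_ord0.
have -> : iota 0 M.+1 = iota 0 M ++ [:: M] by rewrite -addn1 iotaD.
rewrite big_ord_recr ih has_cat /= orbF.
by case: (has b (iota 0 M)); case: (b M).
Qed.

Section Grid.
Context {R : realType} {N : nat}.
Variable p : R.
Hypothesis p01 : 0 <= p <= 1.
Notation cfg := {ffun 'I_N * 'I_N -> bool}.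
Implicit Types (x y : cfg) (e u t : R).

Notation E := (Ex (fun _ : 'I_N * 'I_N => p)).
Notation PP := (Pr (fun _ : 'I_N * 'I_N => p)).
Let q01 : forall _ : 'I_N * 'I_N, 0 <= p <= 1. Proof. by []. Qed.

Definition box k : pred ('I_N * 'I_N) := fun ij => (ij.1 < k)%N && (ij.2 < k)%N.

Definition Sbox k x : R := \sum_(ij | box k ij) ((x ij)%:R - p).

Lemma box_sub k l : (k <= l)%N -> subpred (box k) (box l).
Proof.
by move=> kl ij /andP[a b]; rewrite /box !(leq_trans _ kl).
Qed.

Lemma dep_Sbox k : dep (box k) (Sbox k).
Proof. by move=> x y xy; apply: eq_bigr => ij bij; rewrite xy. Qed.

Lemma Sbox_full x : Sbox N x = \sum_ij ((x ij)%:R - p).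
Proof. by apply: eq_bigl => -[i j]; rewrite /box !ltn_ord. Qed.

(** Split according to the first [k] at which the level [u] is exceeded. The rest of the
    sum is centred and independent of that event, so by [exp y >= 1 + y] it can only
    increase the expected exponential, and one pays for the last sum alone. *)
Lemma Sbox_max e u t : `|e| = 1 -> 0 <= t <= 1 ->
  PP (fun x => has (fun k => u < e * Sbox k x) (iota 0 N.+1)) <=
  expR (p * (1 - p) * (N%:R ^+ 2 * (t ^+ 2 * (2^-1 + t))) - t * u).
Proof.
move=> e1 /andP[t0 t1].
pose b x k := u < e * Sbox k x.
pose first k x := b x k && ~~ has (b x) (iota 0 k).
have dep_first k : dep (box k) (first k).
  move=> x y xy; rewrite /first /b (dep_Sbox xy); congr (_ && ~~ _).
  apply: eq_in_has => l; rewrite mem_iota add0n => /andP[_ lk].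
  rewrite (@dep_Sbox l x y)// => ij /(box_sub (ltnW lk)); exact: xy.
have hasE x : (has (b x) (iota 0 N.+1))%:R = \sum_(k < N.+1) (first k x)%:R :> R.
  by rewrite -sum_first natr_sum.
have step k : (k <= N)%N ->
    E (fun x => (first k x)%:R * expR (t * u)) <=
    E (fun x => (first k x)%:R * expR (t * (e * Sbox N x))).
  move=> kN.
  apply: (@le_trans _ _ (E (fun x => (first k x)%:R * expR (t * (e * Sbox k x))))).
    apply: le_Ex => // x; rewrite /first /b; case: (ltP u _) => /= [ux|_].
      by rewrite ler_wpM2l// ler_expR ler_wpM2l// ltW.
    by rewrite !mul0r.
  pose F x := (first k x)%:R * expR (t * (e * Sbox k x)).
  pose c ij : R := t * (e * (~~ box k ij)%:R).
  have lc x : lin p c x = t * (e * (Sbox N x - Sbox k x)).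
    rewrite Sbox_full /Sbox (bigID (box k))/= addrC addrK /lin.
    rewrite !big_distrr big_mkcond/= [RHS]big_mkcond/=; apply: eq_bigr => ij _.
    by rewrite /c; case: (box k ij) => /=; rewrite ?mulr0 ?mul0r ?mulr1 ?mulrA.
  rewrite [leRHS](_ : _ = E (fun x => F x * expR (lin p c x))); last first.
    apply: eq_Ex => x; rewrite /F -mulrA -expRD lc; congr (_ * expR _); ring.
  rewrite [leRHS](@Ex_indep _ _ _ (box k) F).
  - rewrite ler_peMr//.
      by apply: Ex_ge0 => // x; rewrite mulr_ge0 ?expR_ge0.
    apply: (@le_trans _ _ (E (fun x => 1 + lin p c x))).
      by rewrite ExD Ex_cst (Ex_centered (fun=> p) c) addr0.
    by apply: le_Ex => // x; exact: expR_ge1Dx.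
  - by move=> x y xy; rewrite /F (dep_first k x y xy) (dep_Sbox xy).
  - move=> x y xy; congr expR; apply: eq_bigr => ij _.
    rewrite /c; case: (boolP (box k ij)) => bij /=; last by rewrite xy.
    by rewrite !mulr0 !mul0r.
rewrite addrC expRD mulrC expRN ler_pdivlMr ?expR_gt0//.
rewrite mulrC -ExZ.
apply: (@le_trans _ _ (E (fun x => \sum_(k < N.+1) (first k x)%:R * expR (t * (e * Sbox N x))))).
  rewrite [leRHS]Ex_sum.
  rewrite [leLHS](_ : _ = \sum_(k < N.+1) E (fun x => (first k x)%:R * expR (t * u))); last first.
    by rewrite -Ex_sum; apply: eq_Ex => x; rewrite hasE mulrC big_distrl.
  by apply: ler_sum => k _; apply: step; rewrite -ltnS.
apply: (@le_trans _ _ (E (fun x => expR (lin p (fun=> t * e) x)))).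
  apply: le_Ex => // x; rewrite -big_distrl/= -hasE.
  have -> : t * (e * Sbox N x) = lin p (fun=> t * e) x.
    by rewrite Sbox_full /lin -big_distrr/= mulrA.
  by rewrite ler_piMl ?expR_ge0// lern1 leq_b1.
apply: (le_trans (Ex_expR_lin p01 _)).
  by move=> ij; rewrite normrM e1 mulr1 ger0_norm.
rewrite ler_expR sumr_const card_prod card_ord -(mulr_natl (_ * _)) natrM -expr2.
rewrite exprMn -[e ^+ 2]real_normK ?num_real// e1 expr1n mulr1.
by rewrite normrM e1 mulr1 (ger0_norm t0).
Qed.

(** The shell between two consecutive boxes is disjoint from all the earlier ones. *)
Lemma Ex_shells (m : nat -> nat) (f : nat -> cfg -> R) k0 k1 :
  {homo m : k l / (k <= l)%N} ->
  (forall k, dep (fun ij => box (m k.+1) ij && ~~ box (m k) ij) (f k)) ->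
  E (fun x => \prod_(k0 <= k < k1) f k x) = \prod_(k0 <= k < k1) E (f k).
Proof.
move=> mono df; have [k01|/ltnW k10] := leqP k0 k1; last first.
  by rewrite (big_geq k10) (@eq_Ex _ _ _ _ (fun=> 1)) ?Ex_cst// => x; rewrite big_geq.
elim: k1 k01 => [|k1 ih].
  by rewrite leqn0 => /eqP ->; rewrite big_geq// (@eq_Ex _ _ _ _ (fun=> 1)) ?Ex_cst// => x; rewrite big_geq.
rewrite leq_eqVlt => /orP[/eqP <-|].
  by rewrite big_geq// (@eq_Ex _ _ _ _ (fun=> 1)) ?Ex_cst// => x; rewrite big_geq.
rewrite ltnS => k01; rewrite [RHS]big_nat_recr//= -ih//.
rewrite -(@Ex_indep _ _ _ (box (m k1))).
- by apply: eq_Ex => x; rewrite big_nat_recr.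
- move=> x y xy; apply: eq_big_nat => k /andP[_ kk1]; apply: df => ij /andP[bij _].
  by apply: xy; apply: box_sub bij; exact: mono.
- by move=> x y xy; apply: df => ij /andP[_ nb]; exact: xy.
Qed.

End Grid.

(** * Lower bound for Bernoulli tails by change of measure *)

Section Tilting.
Context {R : realType} {I : finType}.
Variable p : R.
Hypothesis p01 : 0 < p < 1.
Variable B : pred I.
Notation m := (#|B|%:R : R).
Notation PP := (Pr (fun _ : I => p)).
Implicit Type x : {ffun I -> bool}.

Definition Sset x : R := \sum_(i | B i) ((x i)%:R - p).

(** The density of the law with parameter [p] on [B] with respect to that with parameter
    [q] depends on the configuration only through the centred sum. *)
Lemma weight_tilt (q : R) x : p < q < 1 ->
  weight (fun=> p) x = weight (fun i => if B i then q else p) x *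
    expR (- ((m * p + Sset x) * ln (q / p) +
             (m * (1 - p) - Sset x) * ln ((1 - q) / (1 - p)))).
Proof.
move=> /andP[pq q1]; have /andP[p0 p1] := p01.
have q0 : 0 < q by exact: lt_trans pq.
have -> : (m * p + Sset x) * ln (q / p) + (m * (1 - p) - Sset x) * ln ((1 - q) / (1 - p)) =
    \sum_(i | B i) (if x i then ln (q / p) else ln ((1 - q) / (1 - p))).
  have -> : m * p + Sset x = \sum_(i | B i) (x i)%:R.
    by rewrite /Sset sumrB sumr_const mulr_natl addrC subrK.
  have -> : m * (1 - p) - Sset x = \sum_(i | B i) (1 - (x i)%:R).
    rewrite /Sset !sumrB !sumr_const -(mulr_natl p); ring.
  rewrite !big_distrl -big_split/=; apply: eq_bigr => i _.
  by case: (x i); rewrite /= ?mulr1n ?mulr0n ?subrr ?subr0 ?mul0r ?mul1r ?addr0 ?add0r.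
rewrite -sumrN expR_sum /weight (bigID B)/= [in RHS](bigID B)/= mulrAC; congr (_ * _); last first.
  by apply: eq_bigr => i /negbTE ->.
rewrite -big_split/=; apply: eq_bigr => i ->.
case: (x i); rewrite expRN lnK ?posrE ?divr_gt0 ?subr_gt0//; field.
  by rewrite !gt_eqF.
by rewrite !gt_eqF ?subr_gt0.
Qed.

(** The relative entropy expanded to second order; the cubic terms are collected in the
    last summand. The deviation [Z] may exceed [z] by a factor [1 + 2 eta], which costs
    the factor [(1 + eta) (1 + 3 eta)] on the Gaussian exponent. *)
Lemma tilt_exponent_le (M h z Z eta : R) : 0 < M -> 0 < eta <= 1 -> 0 < z ->
  h = (1 + eta) * z / M -> h <= (1 - p) / 2 ->
  z <= Z <= (1 + 2 * eta) * z -> 0 <= M * (1 - p) - Z ->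
  (M * p + Z) * ln ((p + h) / p) + (M * (1 - p) - Z) * ln ((1 - (p + h)) / (1 - p)) <=
  z ^+ 2 / (2 * M * (p * (1 - p))) * ((1 + eta) * (1 + 3 * eta)) +
    (6 / (1 - p) ^+ 2 + 3 / p ^+ 3) * (z ^+ 3 / M ^+ 2).
Proof.
move=> M0 /andP[eta0 eta1] z0 hE hq /andP[zZ Zz] ZM; have /andP[p0 p1] := p01.
have r0 : 0 < 1 - p by rewrite subr_gt0.
have h0 : 0 < h by rewrite hE divr_gt0 ?mulr_gt0//; lra.
have Z0 : 0 < Z by lra.
have a_le : ln ((p + h) / p) <= h / p - (h / p) ^+ 2 / 2 + (h / p) ^+ 3 / 3.
  rewrite mulrDl divff ?gt_eqF//; apply: ln1D_le_cubic.
  by rewrite divr_ge0// ltW.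
have b_le : ln ((1 - (p + h)) / (1 - p)) <= - (h / (1 - p)) - (h / (1 - p)) ^+ 2 / 2.
  rewrite (_ : _ / _ = 1 - h / (1 - p)); last by field; rewrite gt_eqF.
  apply: ln1B_le_quad; rewrite divr_ge0 ?(ltW h0) ?(ltW r0)//=.
  by rewrite ltr_pdivrMr// mul1r; lra.
have MpZ : 0 <= M * p + Z by rewrite addr_ge0 ?mulr_ge0// ltW.
apply: (le_trans (lerD (ler_wpM2l MpZ a_le) (ler_wpM2l ZM b_le))).
have Z3 : Z <= 3 * z by apply: (le_trans Zz); rewrite ler_wpM2r ?(ltW z0)//; lra.
have h2 : h <= 2 * z / M by rewrite hE ler_wpM2r ?invr_ge0 ?(ltW M0)// ler_wpM2r ?(ltW z0)//; lra.
have MpZM : M * p + Z <= M by lra.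
rewrite [leLHS](_ : _ = h * Z / (p * (1 - p)) - h ^+ 2 * M / (2 * (p * (1 - p)))
   - h ^+ 2 * Z / (2 * p ^+ 2) + h ^+ 2 * Z / (2 * (1 - p) ^+ 2) +
   (M * p + Z) * (h ^+ 3 / (3 * p ^+ 3))); last by field; rewrite !gt_eqF.
have t1 : h * Z / (p * (1 - p)) <= (1 + eta) * (1 + 2 * eta) * z ^+ 2 / M / (p * (1 - p)).
  rewrite ler_wpM2r ?invr_ge0 ?mulr_ge0 ?(ltW p0) ?(ltW r0)//.
  apply: (@le_trans _ _ (h * ((1 + 2 * eta) * z))); first by rewrite ler_wpM2l// ltW.
  by apply: eq_lerW; rewrite hE; field; rewrite gt_eqF.
have t2 : h ^+ 2 * M / (2 * (p * (1 - p))) = (1 + eta) ^+ 2 * z ^+ 2 / M / (2 * (p * (1 - p))).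
  by rewrite hE; field; rewrite !gt_eqF.
have t3 : 0 <= h ^+ 2 * Z / (2 * p ^+ 2).
  by rewrite divr_ge0 ?mulr_ge0 ?sqr_ge0// ltW.
have hh : h ^+ 2 <= (2 * z / M) ^+ 2.
  by rewrite lerXn2r ?nnegrE ?divr_ge0 ?mulr_ge0// ltW.
have hhh : h ^+ 3 <= (2 * z / M) ^+ 3.
  by rewrite lerXn2r ?nnegrE ?divr_ge0 ?mulr_ge0// ltW.
have t4 : h ^+ 2 * Z / (2 * (1 - p) ^+ 2) <= 6 / (1 - p) ^+ 2 * (z ^+ 3 / M ^+ 2).
  apply: (@le_trans _ _ ((2 * z / M) ^+ 2 * (3 * z) / (2 * (1 - p) ^+ 2))).
    apply: ler_wpM2r; first by rewrite invr_ge0 mulr_ge0 ?sqr_ge0.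
    by apply: ler_pM; rewrite ?sqr_ge0 ?(ltW Z0).
  by apply: eq_lerW; field; rewrite !gt_eqF.
have t5 : (M * p + Z) * (h ^+ 3 / (3 * p ^+ 3)) <= 3 / p ^+ 3 * (z ^+ 3 / M ^+ 2).
  apply: (@le_trans _ _ (M * ((2 * z / M) ^+ 3 / (3 * p ^+ 3)))).
    apply: ler_pM => //; first by rewrite divr_ge0 ?mulr_ge0 ?exprn_ge0// ltW.
    by rewrite ler_wpM2r ?invr_ge0 ?mulr_ge0 ?exprn_ge0// ltW.
  rewrite [leLHS](_ : _ = 8 / 3 * (z ^+ 3 / (M ^+ 2 * p ^+ 3))); last by field; rewrite !gt_eqF.
  rewrite [leRHS](_ : _ = 3 * (z ^+ 3 / (M ^+ 2 * p ^+ 3))); last by field; rewrite !gt_eqF.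
  rewrite ler_wpM2r ?divr_ge0 ?mulr_ge0 ?exprn_ge0 ?(ltW z0) ?(ltW M0) ?(ltW p0)//; lra.
rewrite t2; move: t1 t3 t4 t5.
rewrite (_ : z ^+ 2 / (2 * M * (p * (1 - p))) * ((1 + eta) * (1 + 3 * eta)) =
   (1 + eta) * (1 + 2 * eta) * z ^+ 2 / M / (p * (1 - p)) -
   (1 + eta) ^+ 2 * z ^+ 2 / M / (2 * (p * (1 - p)))); last by field; rewrite !gt_eqF.
set u1 := _ / (p * (1 - p)); lra.
Qed.

(** Raise the parameter on [B] so that the mean deviation becomes [(1 + eta) z]. By
    Chebyshev, the deviation then lies in [[z, (1 + 2 eta) z]] with probability at least
    [1/2], and there the density is bounded below. *)
Lemma Sset_lower_tail eta z : (0 < #|B|)%N -> 0 < eta <= 1 -> 0 < z ->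
  (1 + eta) * z / m <= (1 - p) / 2 -> m / (2 * eta ^+ 2) <= z ^+ 2 ->
  2^-1 * expR (- (z ^+ 2 / (2 * m * (p * (1 - p))) * ((1 + eta) * (1 + 3 * eta)) +
                  (6 / (1 - p) ^+ 2 + 3 / p ^+ 3) * (z ^+ 3 / m ^+ 2))) <=
  PP (fun x => z <= Sset x).
Proof.
move=> B0 eta01 z0; have /andP[p0 p1] := p01 => hq hz.
have /andP[eta0 eta1] := eta01.
have r0 : 0 < 1 - p by rewrite subr_gt0.
have m0 : 0 < m by rewrite ltr0n.
set h := _ / m in hq; set U := _ + _.
have h0 : 0 < h by rewrite divr_gt0 ?mulr_gt0//; lra.
pose q := p + h.
have q01 : p < q < 1 by rewrite /q; apply/andP; split; lra.
pose qq (i : I) := if B i then q else p.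
have qq01 i : 0 <= qq i <= 1 by rewrite /qq; case: ifP => _; apply/andP; split; case/andP: q01 => *; lra.
pose W x := (z <= Sset x) && (Sset x <= (1 + 2 * eta) * z).
have Zm x : 0 <= m * (1 - p) - Sset x.
  rewrite [X in 0 <= X](_ : _ = \sum_(i | B i) (1 - (x i)%:R)).
    by apply: sumr_ge0 => i _; rewrite subr_ge0 lern1 leq_b1.
  rewrite /Sset !sumrB !sumr_const -(mulr_natl p); ring.
have wle x : W x -> weight qq x * expR (- U) <= weight (fun=> p) x.
  move=> Wx; rewrite (weight_tilt x q01) ler_wpM2l ?weight_ge0//.
  rewrite ler_expR lerN2; apply: (@tilt_exponent_le _ h) => //; exact: Zm.
apply: (@le_trans _ _ (expR (- U) * Pr qq W)).
  rewrite mulrC ler_wpM2l ?expR_ge0//.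
  have -> : Pr qq W = 1 - Pr qq (fun x => ~~ W x) by rewrite Pr_C opprB addrC subrK.
  suff : Pr qq (fun x => ~~ W x) <= 2^-1 by lra.
    (* the sum centred under the tilted law *)
pose L x : R := \sum_i (B i)%:R * ((x i)%:R - qq i).
  have LE x : L x = Sset x - (1 + eta) * z.
    have -> : (1 + eta) * z = m * h by rewrite /h; field; rewrite gt_eqF.
    rewrite mulr_natl -sumr_const /Sset -sumrB [RHS]big_mkcond; apply: eq_bigr => i _.
    rewrite /qq ?unfold_in; case: (B i); rewrite ?mul0r// mul1r /q opprD addrA //.
  have ez0 : 0 < eta * z by rewrite mulr_gt0.
  apply: (@le_trans _ _ (Ex qq (fun x => ((eta * z) ^+ 2)^-1 * L x ^+ 2))).
    apply: markov_Pr => // [x|x nW].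
      by rewrite mulr_ge0 ?invr_ge0 ?sqr_ge0.
    rewrite mulrC ler_pdivlMr ?exprn_gt0// mul1r -[leRHS]real_normK ?num_real//.
    rewrite lerXn2r ?nnegrE ?(ltW ez0)// LE.
    move: nW; rewrite /W negb_and -!ltNge => /orP[hh|hh].
      by rewrite ler0_norm; lra.
    by rewrite ger0_norm; lra.
  rewrite ExZ Ex_sqr.
  apply: (@le_trans _ _ (((eta * z) ^+ 2)^-1 * (m * 4^-1))).
    rewrite ler_wpM2l ?invr_ge0 ?sqr_ge0// mulr_natl -sumr_const [leRHS]big_mkcond.
    apply: ler_sum => i _; rewrite unfold_in; case: (B i); last by rewrite expr0n mul0r.
    rewrite expr1n mul1r; have := @p1p_le R (qq i) (qq01 i); by case/andP.
  rewrite mulrC ler_pdivrMr ?exprn_gt0// exprMn.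
  rewrite mulrCA; move: hz; rewrite ler_pdivrMr ?mulr_gt0 ?exprn_gt0// => hz.
  by move: hz; set e2 := eta ^+ 2; set z2 := z ^+ 2; lra.
rewrite -ExZ; apply: (@le_trans _ _ (Pr (fun=> p) W)).
  apply: ler_sum => x _; case: (boolP (W x)) => [/wle h1|_]; last by rewrite !mulr0.
  by rewrite !mulr1.
by apply: Pr_le => [i|x /andP[]//]; rewrite !ltW.
Qed.

End Tilting.

(** * Almost sure comparison with the edge surplus *)

(** The first Borel-Cantelli lemma for bounds that hold from some index on. *)
Lemma borel_cantelli_ae {R : realType} {d : measure_display} {T : measurableType d}
    (P : probability T R) (F : nat -> set T) (u : nat -> R) (C : R) (k0 : nat) :
  (forall k, measurable (F k)) ->
  (forall k, (k0 <= k)%N -> (P (F k) <= (u k)%:E)%E) ->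
  (forall n, \sum_(k0 <= k < n) u k <= C) ->
  \forall t \ae P, \forall k \near \oo, ~ F k t.
Proof.
move=> mF Fu uC.
pose F' k := if (k0 <= k)%N then F k else set0.
have mF' k : measurable (F' k) by rewrite /F'; case: ifP.
have P0 : P (lim_sup_set F') = 0%E.
  apply: lim_sup_set_cvg0 => //.
  apply: (@le_lt_trans _ _ C%:E); last exact: ltry.
  apply: lime_le; first exact: is_cvg_nneseries.
  apply: nearW => n; apply: (@le_trans _ _ (\sum_(k0 <= k < n) u k)%:E); last by rewrite lee_fin.
  rewrite -sumEFin.
  have [nk|kn] := leqP n k0.
    rewrite [leRHS]big_geq// big_nat big1// => k /andP[_ kn].
    by rewrite /F' leqNgt (leq_trans kn nk)/= measure0.
  rewrite (big_cat_nat (n := k0))//=; last exact: ltnW.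
  rewrite [X in (X + _)%E](_ : _ = 0%E) ?add0e.
    rewrite big_nat [leRHS]big_nat; apply: lee_sum => k /andP[kk _].
    by rewrite /F' kk; exact: Fu.
  by rewrite big_nat big1// => k /andP[_ kk]; rewrite /F' leqNgt kk measure0.
exists (lim_sup_set F'); split => //.
  apply: bigcap_measurableType => n _; exact: bigcup_measurable.
move=> t /= nt k _; apply: contrapT => nk; apply: nt.
exists (maxn k k0) => // j /=; rewrite geq_max => /andP[kj k0j] Fj.
by apply: nk; exists j => //; rewrite /F' k0j.
Qed.

Lemma sum_invsqr_le {R : realType} n : \sum_(2 <= k < n) (k%:R ^+ 2)^-1 <= 1 :> R.
Proof.
have [n2|n2] := leqP n 2; first by rewrite big_geq.
apply: (@le_trans _ _ (1 - (n.-1)%:R^-1)); last by rewrite gerBl.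
elim: n n2 => [//|n ih]; rewrite ltnS leq_eqVlt => /orP[/eqP <-|n2].
  by rewrite big_nat1 /= ; lra.
rewrite big_nat_recr/= 1?ltnW//.
apply: le_trans (lerD (ih n2) (lexx _)) _.
have n0 : 0 < (n.-1)%:R :> R by rewrite ltr0n -subn1 subn_gt0 ltnW.
have nE : n%:R = (n.-1)%:R + 1 :> R by rewrite natr1 prednK// (leq_trans _ n2).
rewrite nE; move: (n.-1)%:R n0 => a a0.
have -> : 1 - a^-1 + ((a + 1) ^+ 2)^-1 = 1 - (a + 1)^-1 - (a * (a + 1) ^+ 2)^-1.
  by field; rewrite !gt_eqF//; lra.
by rewrite gerBl invr_ge0 mulr_ge0 ?sqr_ge0// ltW.
Qed.

Section AlmostSure.
Context {R : realType} {d : measure_display} {T : measurableType d}.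
Variables (P : probability T R) (p : R).
Hypothesis hp : 0 < p < 1.
Variable G : nat * nat -> {RV P >-> bool}.
Hypothesis hG : random_bipartite_graph p G.

Let p01 : 0 <= p <= 1. Proof. by have /andP[a b] := hp; rewrite !ltW. Qed.

Definition surplus n (t : T) : R :=
  \sum_(i < n) \sum_(j < n) ((G (i : nat, j : nat) t)%:R - p).

(** The same quantity read on any larger square, so that all [n <= N] live on one finite
    space. *)
Lemma surplus_box n N t : (n <= N)%N -> surplus n t = Sbox p n (restr G N t).
Proof.
move=> nN; rewrite /surplus /Sbox.
rewrite (big_ord_widen N (fun i => \sum_(j < n) ((G (i, j : nat) t)%:R - p)))//.
under eq_bigr => i _ do rewrite (big_ord_widen N (fun j => (G (i : nat, j) t)%:R - p))//.
rewrite pair_big_dep/=; apply: eq_big => [[i j]//|[i j] _].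
by rewrite ffunE.
Qed.

Lemma surplus_rowdev n t : \sum_i rowdev p (restr G n t) i = surplus n t.
Proof.
by apply: eq_bigr => i _; apply: eq_bigr => j _; rewrite ffunE.
Qed.

Lemma typicalP n t : (0 < n)%N -> typical p (restr G n t) ->
  (0 < X G n t)%N /\
  `|ln (X G n t)%:R - ln (n`!%:R * p ^+ n) - surplus n t / (n%:R * p)| <= 1 + 4 / p ^+ 2.
Proof.
by move=> n0; rewrite /typical -X_rowper// surplus_rowdev ltr0n => /andP.
Qed.

Lemma ae_typical : \forall t \ae P, \forall n \near \oo, typical p (restr G n t).
Proof.
have [K K0 [n0 _ HK]] := Pr_not_typical hp.
pose F n := [set t | ~~ typical p (restr G n t)].
have : \forall t \ae P, \forall n \near \oo, ~ F n t.
  apply: (@borel_cantelli_ae _ _ _ P F (fun n => K / n%:R ^+ 2) K (maxn 2 n0)).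
  - by move=> n; have [] := restr_prob hG (fun x : {ffun 'I_n * 'I_n -> bool} => ~~ typical p x).
  - move=> n; rewrite geq_max => /andP[n2 n0n].
    have [_ ->] := restr_prob hG (fun x : {ffun 'I_n * 'I_n -> bool} => ~~ typical p x).
    by rewrite lee_fin; apply: HK.
  - move=> n; rewrite -big_distrr/= -[leRHS]mulr1 ler_wpM2l ?(ltW K0)//.
    apply: le_trans (sum_invsqr_le n).
    have [nm|mn] := leqP n (maxn 2 n0).
      by rewrite big_geq// sumr_ge0// => k _; rewrite invr_ge0 sqr_ge0.
    rewrite [leRHS](big_cat_nat (n := maxn 2 n0))/= ?leq_maxl// 1?ltnW//.
    by rewrite lerDr sumr_ge0// => k _; rewrite invr_ge0 sqr_ge0.
apply: filterS => t; apply: filterS => n; rewrite /F /=.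
by move=> /negP; rewrite negbK.
Qed.

End AlmostSure.

Lemma limn_esup_eq1 {R : realType} (u : nat -> \bar R) :
  (forall e : R, 0 < e -> \forall n \near \oo, (u n <= (1 + e)%:E)%E) ->
  (forall (e : R) N, 0 < e -> exists2 n, (N <= n)%N & ((1 - e)%:E <= u n)%E) ->
  limn_esup u = 1%E.
Proof.
move=> up lo; apply/eqP; rewrite eq_le; apply/andP; split.
  apply/lee_addgt0Pr => e e0; rewrite -EFinD.
  apply: ge_ereal_inf; exists (ereal_sup (u @` [set n | (u n <= (1 + e)%:E)%E])).
    by exists [set n | (u n <= (1 + e)%:E)%E] => //; exact: up.
  by apply: ge_ereal_sup => _ [n ? <-].
apply/lee_subgt0Pr => e e0; rewrite -EFinB.
apply: le_ereal_inf_tmp => _ [A [N _ NA] <-].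
have [n Nn ln] := lo e N e0.
by apply: (le_trans ln); apply: ereal_sup_ubound; exists n => //; exact: NA.
Qed.

(** * Law of the iterated logarithm: upper half *)

(** The terms are [k^(-1-a)]; they are dominated by the telescoping differences of
    [k^(-a) / a]. *)
Lemma sum_expR_ln_le {R : realType} (a : R) n : 0 < a ->
  \sum_(2 <= k < n) expR (- (1 + a) * ln k%:R) <= a^-1.
Proof.
move=> a0; pose v k : R := expR (- a * ln k%:R).
have vk k : (1 < k)%N -> expR (- (1 + a) * ln k%:R) <= (v k.-1 - v k) / a.
  move=> k1; have k0 : 0 < k%:R :> R by rewrite ltr0n ltnW.
  have k10 : 0 < (k.-1)%:R :> R by rewrite ltr0n -subn1 subn_gt0.
  have -> : expR (- (1 + a) * ln k%:R) = v k / k%:R.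
    by rewrite /v opprD mulrDl mulN1r expRD expRN lnK ?posrE// mulrC.
  rewrite ler_pdivlMr// -mulrA mulrC.
  have -> : v k.-1 = v k * expR (a * (ln k%:R - ln (k.-1)%:R)).
    by rewrite /v -expRD; congr expR; ring.
  rewrite -[X in _ - X]mulr1 -mulrBr mulrC ler_wpM2l ?expR_ge0//.
  rewrite lerBrDl (le_trans _ (expR_ge1Dx _))// lerD2l mulrC ler_wpM2l ?(ltW a0)//.
  rewrite -ln_div ?posrE//.
  have -> : k%:R^-1 = - ((k.-1)%:R / k%:R - 1) :> R.
    by rewrite -[k in LHS]prednK 1?ltnW// -[k in X in _ / X]prednK 1?ltnW// -natr1; field; lra.
  rewrite lerNl -lnV ?posrE ?divr_gt0// invf_div.
  set z := _ / _; rewrite (_ : ln z = ln (1 + (z - 1))); last by congr ln; ring.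
  by apply: le_ln1Dx; rewrite ltrBrDl subrr divr_gt0.
have [n2|n2] := leqP n 2; first by rewrite big_geq// invr_ge0 ltW.
apply: (@le_trans _ _ (\sum_(2 <= k < n) (v k.-1 - v k) / a)).
  by rewrite big_nat [leRHS]big_nat; apply: ler_sum => k /andP[k2 _]; exact: vk.
rewrite -big_distrl/= ler_pdivrMr// mulVf ?gt_eqF//.
have -> : \sum_(2 <= k < n) (v k.-1 - v k) = v 1%N - v n.-1.
  elim: n n2 => [//|n ih]; rewrite ltnS leq_eqVlt => /orP[/eqP <-|n2].
    by rewrite big_nat1.
  by rewrite big_nat_recr/= 1?ltnW// ih//; ring.
by rewrite /v ln1 mulr0 expR0 gerBl expR_ge0.
Qed.

Section Upper.
Context {R : realType} {d : measure_display} {T : measurableType d}.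
Variables (P : probability T R) (p : R).
Hypothesis hp : 0 < p < 1.
Variable G : nat * nat -> {RV P >-> bool}.
Hypothesis hG : random_bipartite_graph p G.

Let p01 : 0 <= p <= 1. Proof. by have /andP[a b] := hp; rewrite !ltW. Qed.

Definition sigma : R := Num.sqrt (p * (1 - p)).
(** Applied to [ln n], this is the normalisation [sqrt (2 log log n)]. *)
Definition sqrt2ln (y : R) : R := Num.sqrt (2 * ln y).

Lemma sigma_gt0 : 0 < sigma.
Proof. by have /andP[a b] := hp; rewrite sqrtr_gt0 mulr_gt0// subr_gt0. Qed.

Lemma sigma_sqr : sigma ^+ 2 = p * (1 - p).
Proof. by have /andP[a b] := hp; rewrite sqr_sqrtr// mulr_ge0 ?subr_ge0// ltW. Qed.

Lemma sqrt2ln_ge0 y : 0 <= sqrt2ln y. Proof. exact: sqrtr_ge0. Qed.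

Lemma sqrt2ln_sqr y : 1 <= y -> sqrt2ln y ^+ 2 = 2 * ln y.
Proof. by move=> y1; rewrite sqr_sqrtr// mulr_ge0// ln_ge0. Qed.

Lemma sqrt2ln_le y : 1 <= y -> sqrt2ln y <= y.
Proof.
move=> y1; have y0 : 0 < y by lra.
rewrite -(@ler_pXn2r _ 2) ?nnegrE ?sqrt2ln_ge0 ?(ltW y0)// sqrt2ln_sqr//.
have : ln (1 + (y - 1)) <= y - 1 by apply: le_ln1Dx; lra.
by rewrite addrC subrK => h; have := sqr_ge0 (y - 1); rewrite sqrrB; lra.
Qed.

Lemma sqrt2ln_mono y z : 1 <= y -> y <= z -> sqrt2ln y <= sqrt2ln z.
Proof.
move=> y1 yz; rewrite ler_wsqrtr// ler_wpM2l// ler_ln ?posrE//; lra.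
Qed.

Lemma expRN_le_sqr (y : R) : 0 < y -> expR (- y) <= 2 / y ^+ 2.
Proof.
move=> y0; rewrite expRN -[leRHS]invrK lef_pV2 ?posrE ?expR_gt0 ?invr_gt0 ?divr_gt0 ?exprn_gt0//.
rewrite invf_div; apply: le_trans (expR_ge1Dxn 1 (ltW y0)).
by rewrite lerDr.
Qed.

(** The block of [exp y <= n <= exp (y + ln (1 + dl) / 2)]. Passing from the beginning to
    the end of the block multiplies the variance by [1 + dl], while the level carries a
    factor [(1 + dl)^2] in the square; the remaining factor [1 + dl] in the exponent makes
    the bounds summable over blocks, even after half of [dl] is spent on the third order
    term. *)
Lemma Pr_block (e dl y : R) (N : nat) : `|e| = 1 -> 0 < dl -> 1 <= y ->
  8 * (1 + dl) / (dl * sigma) <= y ->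
  N%:R <= expR (y + ln (1 + dl) / 2) ->
  Pr (fun _ : 'I_N * 'I_N => p) (fun x => has (fun k =>
    (1 + dl) * sigma * expR y * sqrt2ln y < e * Sbox p k x) (iota 0 N.+1)) <=
  expR (- (1 + dl / 2) * ln y).
Proof.
move=> e1 dl0 y1 yb NM; have s0 := sigma_gt0; have s2 := sigma_sqr.
have y0 : 0 < y by lra.
set M := expR _ in NM; set u := _ * sqrt2ln y.
(* the minimiser [u / (sigma^2 M^2)] of the exponent without its cubic term *)
pose t := sqrt2ln y * expR (- y) / sigma.
have t0 : 0 <= t by rewrite divr_ge0 ?mulr_ge0 ?sqrt2ln_ge0 ?expR_ge0// ltW.
have dl10 : 0 < 1 + dl by lra.
have t_le : 2 * t * (1 + dl) <= dl / 2.
  have : t <= 2 / (y * sigma).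
    rewrite /t ler_pdivrMr// [leRHS](_ : _ = y * (2 / y ^+ 2)); last by field; rewrite !gt_eqF.
    by apply: ler_pM; rewrite ?sqrt2ln_ge0 ?expR_ge0 ?sqrt2ln_le ?expRN_le_sqr.
  rewrite ler_pdivlMr ?mulr_gt0// => h.
  move: yb; rewrite ler_pdivrMr ?mulr_gt0// => h2.
  have ys0 : 0 < y * sigma by rewrite mulr_gt0.
  rewrite -(ler_pM2r ys0).
  rewrite [leLHS](_ : _ = 2 * (1 + dl) * (t * (y * sigma))); last by ring.
  apply: (@le_trans _ _ (2 * (1 + dl) * 2)); first by rewrite ler_wpM2l// mulr_ge0// ltW.
  have -> : dl / 2 * (y * sigma) = y * (dl * sigma) / 2 by field.
  by rewrite ler_pdivlMr//; apply: le_trans h2; lra.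
have t1 : t <= 1.
  have h : t * (1 + dl) <= 1 * (1 + dl) by lra.
  by rewrite ler_pM2r in h.
apply: le_trans (Sbox_max p01 u e1 (_ : 0 <= t <= 1)) _; first by rewrite t0 t1.
rewrite ler_expR -s2.
have M0 : 0 < M by exact: expR_gt0.
have hM : M ^+ 2 = expR y ^+ 2 * (1 + dl).
  rewrite /M expRD exprMn; congr (_ * _).
  by rewrite -expRM_natr mulfVK// lnK// posrE.
have ut : u * t = (1 + dl) * (2 * ln y).
  rewrite -sqrt2ln_sqr// /u /t expRN; field.
  by rewrite !gt_eqF ?expR_gt0.
have MT : sigma ^+ 2 * (M ^+ 2 * t ^+ 2) = u * t.
  rewrite ut -sqrt2ln_sqr// hM /t expRN; field.
  by rewrite !gt_eqF ?expR_gt0.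
apply: (@le_trans _ _ (sigma ^+ 2 * (M ^+ 2 * (t ^+ 2 * (2^-1 + t))) - t * u)).
  rewrite lerD2r ler_wpM2l ?sqr_ge0// ler_wpM2r//.
    by rewrite mulr_ge0 ?sqr_ge0// addr_ge0.
  by rewrite lerXn2r ?nnegrE// ltW.
rewrite [leLHS](_ : _ = sigma ^+ 2 * (M ^+ 2 * t ^+ 2) * (2^-1 + t) - u * t); last by ring.
rewrite MT ut.
have l0 := ln_ge0 y1.
rewrite -subr_ge0 [X in 0 <= X](_ : _ = (dl / 2 - 2 * t * (1 + dl)) * ln y); last by field.
by rewrite mulr_ge0// subr_ge0.
Qed.

(** The sign [e] is arbitrary because the lower half needs a bound from below on the sum
    over the previous square. *)
Lemma lil_upper (e dl : R) : `|e| = 1 -> 0 < dl ->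
  \forall t \ae P, \forall n \near \oo,
    e * surplus p G n t <= (1 + dl) * sigma * n%:R * sqrt2ln (ln n%:R).
Proof.
move=> e1 dl0; have s0 := sigma_gt0.
pose eta := ln (1 + dl) / 2.
have eta0 : 0 < eta by rewrite divr_gt0// ln_gt0//; lra.
pose Y0 := Num.max 1 (8 * (1 + dl) / (dl * sigma)).
pose y k : R := k%:R * eta.
pose N k := Num.truncn (expR (y k + eta)).
have NM k : (N k)%:R <= expR (y k + eta) by rewrite truncn_le// expR_ge0.
pose Q k (x : {ffun 'I_(N k) * 'I_(N k) -> bool}) := has (fun j =>
    (1 + dl) * sigma * expR (y k) * sqrt2ln (y k) < e * Sbox p j x) (iota 0 (N k).+1).
pose F k := [set t | Q k (restr G (N k) t)].
(* from this block on, [Pr_block] applies *)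
pose k0 := maxn 2 (Num.truncn (Y0 / eta)).+1.
have k0y k : (k0 <= k)%N -> Y0 <= y k.
  rewrite geq_max => /andP[_ kk]; rewrite /y -ler_pdivrMr//.
  by apply: ltW; apply: (lt_le_trans (truncnS_gt _)); rewrite ler_nat.
have : \forall t \ae P, \forall k \near \oo, ~ F k t.
  pose a := dl / 2; have a0 : 0 < a by rewrite divr_gt0.
  apply: (@borel_cantelli_ae _ _ _ P F (fun k => expR (- (1 + a) * ln (y k)))
     (expR (- (1 + a) * ln eta) * a^-1) k0).
  - by move=> k; have [] := restr_prob hG (@Q k).
  - move=> k kk; have [_ ->] := restr_prob hG (@Q k); rewrite lee_fin.
    have := k0y k kk; rewrite ge_max => /andP[y1 yb].
    exact: Pr_block.
  - move=> n.
    apply: (@le_trans _ _ (\sum_(k0 <= k < n) expR (- (1 + a) * ln eta) * expR (- (1 + a) * ln k%:R))).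
      rewrite big_nat [leRHS]big_nat; apply: ler_sum => k /andP[kk _].
      have kR0 : 0 < k%:R :> R.
        by rewrite ltr0n; apply: leq_trans kk; rewrite /k0 leq_max.
      by rewrite -expRD -mulrDr /y lnM ?posrE// (addrC (ln k%:R)).
    rewrite -big_distrr/= ler_wpM2l ?expR_ge0//.
    apply: le_trans (sum_expR_ln_le n a0).
    have [nm|mn] := leqP n k0.
      by rewrite big_geq// sumr_ge0// => k _; rewrite expR_ge0.
    rewrite [leRHS](big_cat_nat (n := k0))/= ?leq_maxl// 1?ltnW//.
    by rewrite lerDr sumr_ge0// => k _; rewrite expR_ge0.
apply: filterS => t -[k1 _ Hk1].
pose k2 := maxn k0 k1.
exists (Num.truncn (expR (y k2))).+1 => // n /= n_ge.
have nge : expR (y k2) <= n%:R.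
  by apply: ltW; apply: (lt_le_trans (truncnS_gt _)); rewrite ler_nat.
have n0 : 0 < n%:R :> R by apply: lt_le_trans nge; exact: expR_gt0.
have lnn : y k2 <= ln n%:R by rewrite -[leLHS]expRK ler_ln ?posrE ?expR_gt0.
have lneta0 : 0 <= ln n%:R / eta.
  by rewrite divr_ge0 ?(ltW eta0)// (le_trans _ lnn)// mulr_ge0// ltW.
pose k := Num.truncn (ln n%:R / eta).
have kn : y k <= ln n%:R by have /andP[h _] := truncn_itv lneta0; rewrite /y -ler_pdivlMr.
have nk : ln n%:R <= y k + eta.
  have := truncnS_gt (ln n%:R / eta); rewrite -/k ltr_pdivrMr// -natr1 mulrDl mul1r.
  exact: ltW.
have k2k : (k2 <= k)%N by rewrite /k truncn_ge_nat// ler_pdivlMr.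
have k0k : (k0 <= k)%N by rewrite (leq_trans _ k2k)// leq_maxl.
have := Hk1 k (leq_trans (leq_maxr _ _) k2k).
have := k0y k k0k; rewrite ge_max => /andP[y1 _].
have nN : (n <= N k)%N.
  by rewrite truncn_ge_nat ?expR_ge0// -[leLHS]lnK ?posrE// ler_expR.
move=> /negP/hasPn/(_ n); rewrite mem_iota add0n ltnS nN => /(_ isT).
rewrite -leNgt -surplus_box// => H; apply: (le_trans H).
have en : expR (y k) <= n%:R by rewrite -[leRHS]lnK ?posrE// ler_expR.
have c0 : 0 <= (1 + dl) * sigma by rewrite mulr_ge0 ?(ltW s0)//; lra.
apply: ler_pM; rewrite ?sqrt2ln_ge0 ?sqrt2ln_mono//.
  by rewrite mulr_ge0 ?expR_ge0.
by rewrite ler_wpM2l.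
Qed.

End Upper.

(** * Law of the iterated logarithm: lower half *)

Lemma harmonic_unbounded {R : realType} (k0 : nat) (B : R) :
  exists k1, B <= \sum_(k0 <= k < k1) (k.+1%:R)^-1.
Proof.
apply: contrapT => nB; apply: (@dvg_harmonic R).
have inc n : 0 <= (n.+1%:R : R)^-1 by rewrite invr_ge0.
apply: nondecreasing_is_cvgn.
  by apply: nondecreasing_series => i _ _; exact: inc.
exists (\sum_(0 <= k < k0) (k.+1%:R)^-1 + B) => _ [n _ <-].
have [nk|kn] := leqP n k0.
  rewrite /series/= [leRHS]addrC.
  have B0 : 0 <= B.
    by rewrite leNgt; apply/negP => B0; apply: nB; exists 0%N; rewrite big_geq// ltW.
  rewrite (big_cat_nat (n := n) (p := k0))//= addrCA lerDl addr_ge0//.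
  by rewrite sumr_ge0.
rewrite /series/= (big_cat_nat (n := k0) (p := n))//= 1?ltnW// lerD2l leNgt.
by apply/negP => /ltW lt; apply: nB; exists n.
Qed.

Section Shell.
Context {R : realType} {N : nat}.
Variable p : R.

Definition shell a b : pred ('I_N * 'I_N) := fun ij => box b ij && ~~ box a ij.

Lemma card_box k : (k <= N)%N -> #|@box N k| = (k ^ 2)%N.
Proof.
move=> kN; rewrite -sum1_card.
transitivity (\sum_(i < k) \sum_(j < k) 1)%N.
  rewrite (big_ord_widen N (fun=> (\sum_(j < k) 1)%N))//.
  under [RHS]eq_bigr => i _ do rewrite (big_ord_widen N (fun=> 1%N))//.
  by rewrite pair_big_dep/=; apply: eq_bigl => -[i j].
by rewrite !sum_nat_const !card_ord muln1 mulnn.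
Qed.

Lemma sum_shell a b (F : 'I_N * 'I_N -> R) : (a <= b)%N ->
  \sum_(ij | shell a b ij) F ij = \sum_(ij | box b ij) F ij - \sum_(ij | box a ij) F ij.
Proof.
move=> ab; rewrite [X in _ = X - _](bigID (box a))/=.
rewrite [X in _ = X + _ - _](_ : _ = \sum_(ij | box a ij) F ij).
  by rewrite addrAC subrr add0r.
by apply: eq_bigl => ij; apply: andb_idl => h; exact: box_sub h.
Qed.

Lemma card_shell a b : (a <= b)%N -> (b <= N)%N ->
  #|shell a b|%:R = b%:R ^+ 2 - a%:R ^+ 2 :> R.
Proof.
move=> ab bN; rewrite -!natrX -(card_box bN) -(card_box (leq_trans ab bN)).
rewrite -!sum1_card !natr_sum; exact: sum_shell.
Qed.

Lemma Sset_shell a b x : (a <= b)%N ->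
  Sset p (shell a b) x = Sbox p b x - Sbox p a x.
Proof. exact: sum_shell. Qed.

End Shell.

Section Lower.
Context {R : realType} {d : measure_display} {T : measurableType d}.
Variables (P : probability T R) (p : R).
Hypothesis hp : 0 < p < 1.
Variable G : nat * nat -> {RV P >-> bool}.
Hypothesis hG : random_bipartite_graph p G.

Let p01 : 0 <= p <= 1. Proof. by have /andP[a b] := hp; rewrite !ltW. Qed.
Notation sigma := (sigma p).

Lemma sigma_le1 : sigma <= 1.
Proof.
have /andP[_ h] := @p1p_le R p p01.
rewrite -(@ler_pXn2r _ 2) ?nnegrE ?(ltW (sigma_gt0 hp))// sigma_sqr// expr1n; lra.
Qed.

Variables (dl : R) (c : nat).
Hypotheses (dl01 : 0 < dl <= 1) (c_ge : 4 / dl <= c%:R).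

Let dl0 : 0 < dl. Proof. by case/andP: dl01. Qed.
Let dl1 : dl <= 1. Proof. by case/andP: dl01. Qed.
Let c4 : 4 <= c%:R :> R.
Proof. by apply: le_trans c_ge; rewrite ler_pdivlMr//; have := dl1; lra. Qed.
Let c0 : 0 < c%:R :> R. Proof. by have := c4; lra. Qed.
Let c_gt1 : (1 < c)%N.
Proof. by rewrite -(ltr_nat R); have := c4; lra. Qed.

(** The square of side [c^(k+1)] has almost all of its cells in the last shell as [c] is
    at least [4 / dl]; the half of [dl] that is given up here pays for this, for the loss
    in the tail bound, and leaves the other half for the previous square. *)
Definition level k : R := (1 - dl / 2) * sigma * (c ^ k.+1)%:R * sqrt2ln (ln (c ^ k.+1)%:R).

(** The hypotheses of the tail bound for the shell hold as soon as [y = ln (c^(k+1))] is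
    large, with the choice [eta = dl / 16]. Its exponent is then at most [ln y] up to a
    constant: [(1 - dl/2)^2 (1 + eta) (1 + 3 eta) <= 1 - dl^2/16 <= 1 - 1/c^2]. *)
Lemma shell_tilt_conditions (M y E : R) : M = E ^+ 2 * (1 - (c%:R ^+ 2)^-1) ->
  E = expR y -> 1 <= y -> 16 / (1 - p) <= y ->
  expR (((dl / 16) ^+ 2 * sigma ^+ 2)^-1) <= y ->
  let eta := dl / 16 in let z := (1 - dl / 2) * sigma * E * sqrt2ln y in
  [/\ 0 < M, 0 < z, (1 + eta) * z / M <= (1 - p) / 2, M / (2 * eta ^+ 2) <= z ^+ 2 &
   z ^+ 2 / (2 * M * (p * (1 - p))) * ((1 + eta) * (1 + 3 * eta)) <= ln y /\
   z ^+ 3 / M ^+ 2 <= 24].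
Proof.
have dlp := dl0; have dlq := dl1.
move=> ME EE y1 yp ye eta z; have s0 := sigma_gt0 hp; have s2 := sigma_sqr hp.
have /andP[p0 p1] := hp.
have y0 : 0 < y by lra.
have E0 : 0 < E by rewrite EE expR_gt0.
set q := (c%:R ^+ 2)^-1 in ME.
have q0 : 0 < q by rewrite invr_gt0 exprn_gt0.
have qdl : q <= dl ^+ 2 / 16.
  rewrite /q -[leRHS]invrK lef_pV2 ?posrE ?invr_gt0 ?divr_gt0 ?exprn_gt0//.
  rewrite invf_div (_ : 16 / dl ^+ 2 = (4 / dl) ^+ 2); last by field; rewrite gt_eqF.
  by rewrite lerXn2r ?nnegrE// ?divr_ge0// ltW.
have dl2 : dl ^+ 2 <= dl by rewrite expr2 ler_piMl// ltW.
have q1 : q <= 1 / 16 by have := dl1; lra.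
have M0 : 0 < M by rewrite ME mulr_gt0 ?exprn_gt0//; lra.
have ME2 : M <= E ^+ 2 by rewrite ME ler_piMr ?sqr_ge0//; lra.
have ME1 : E ^+ 2 / 2 <= M by rewrite ME ler_wpM2l ?sqr_ge0//; lra.
have lny : ((eta ^+ 2 * sigma ^+ 2)^-1) <= ln y by rewrite -[leLHS]expRK ler_ln ?posrE ?expR_gt0.
have eta0 : 0 < eta by rewrite /eta; lra.
have es0 : 0 < eta ^+ 2 * sigma ^+ 2 by rewrite mulr_gt0 ?exprn_gt0.
have lny0 : 0 < ln y by apply: lt_le_trans lny; rewrite invr_gt0.
have sl0 : 0 < sqrt2ln y by rewrite sqrtr_gt0 mulr_gt0.
have sl2 := sqrt2ln_sqr y1; have sly := sqrt2ln_le y1.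
have s1 := sigma_le1.
have a0 : 0 < 1 - dl / 2 by lra.
have a1 : 1 - dl / 2 <= 1 by lra.
have z0 : 0 < z by rewrite /z !mulr_gt0.
have z_le : z <= E * y.
  rewrite /z; apply: ler_pM => //; rewrite ?mulr_ge0 ?(ltW a0) ?(ltW s0) ?(ltW E0) ?(ltW sl0)//.
  by rewrite ler_piMl ?(ltW E0)// mulr_ile1// ltW.
have Ey2 : y ^+ 2 / 2 <= E.
  by rewrite EE; apply: le_trans (expR_ge1Dxn 1 (ltW y0)); rewrite lerDr.
have Ey3 : y ^+ 3 / 6 <= E.
  by rewrite EE; apply: le_trans (expR_ge1Dxn 2 (ltW y0)); rewrite lerDr.
have z2 : z ^+ 2 = (1 - dl / 2) ^+ 2 * sigma ^+ 2 * E ^+ 2 * (2 * ln y).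
  by rewrite -sl2 /z; ring.
split => //.
- rewrite ler_pdivrMr//.
  apply: (@le_trans _ _ (2 * (E * y))).
    by apply: ler_pM; rewrite ?(ltW z0)//; rewrite /eta; lra.
  apply: (@le_trans _ _ ((1 - p) / 2 * (E ^+ 2 / 2))); last by rewrite ler_wpM2l//; lra.
  rewrite expr2 (_ : _ * (E * E / 2) = E * ((1 - p) * E / 4)); last by field.
  rewrite mulrCA ler_wpM2l ?(ltW E0)//.
  move: yp; rewrite ler_pdivrMr; last by lra.
  move=> yp; have r0 : 0 <= 1 - p by lra.
  have h1 : (1 - p) * (y ^+ 2 / 2) <= (1 - p) * E by rewrite ler_wpM2l.
  have h2 : 16 * y <= (1 - p) * y ^+ 2.
    by rewrite expr2 mulrA [(1 - p) * y]mulrC ler_wpM2r// ltW.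
  lra.
- rewrite ler_pdivrMr ?mulr_gt0 ?exprn_gt0//; apply: (le_trans ME2).
  rewrite z2 (_ : _ * (2 * eta ^+ 2) = E ^+ 2 * ((1 - dl / 2) ^+ 2 * 4 * (eta ^+ 2 * sigma ^+ 2 * ln y))); last by ring.
  rewrite ler_peMr ?sqr_ge0//.
  have h1 : 1 <= eta ^+ 2 * sigma ^+ 2 * ln y.
    by rewrite -ler_pdivrMl// mulr1.
  have h2 : 1 <= (1 - dl / 2) ^+ 2 * 4.
    have : 2^-1 ^+ 2 <= (1 - dl / 2) ^+ 2 by rewrite lerXn2r ?nnegrE//; lra.
    lra.
  by apply: mulr_ege1.
- split.
    rewrite z2 -s2 ME.
    have s20 : sigma ^+ 2 != 0 by rewrite gt_eqF// exprn_gt0.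
    have q10 : 0 < 1 - q by lra.
    rewrite [leLHS](_ : _ = (1 - dl / 2) ^+ 2 * ((1 + eta) * (1 + 3 * eta)) / (1 - q) * ln y); last first.
      by field; rewrite !gt_eqF.
    rewrite ler_piMl ?(ltW lny0)// ler_pdivrMr// mul1r.
    apply: (@le_trans _ _ (1 - dl ^+ 2 / 16)); last by lra.
    rewrite /eta -subr_ge0.
    rewrite [X in 0 <= X](_ : _ = dl *
        (3 / 4 - 19 / 256 * dl - 13 / 256 * dl ^+ 2 - 3 / 1024 * (dl * dl ^+ 2))); last by field.
    apply: mulr_ge0; first exact: (ltW dlp).
    have dl3 : dl * dl ^+ 2 <= dl ^+ 2.
      by apply: ler_piMl; [exact: sqr_ge0|exact: dlq].
    lra.
  rewrite ler_pdivrMr ?exprn_gt0//.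
  apply: (@le_trans _ _ (24 * (E ^+ 2 / 2) ^+ 2)); last first.
    by rewrite ler_wpM2l// lerXn2r ?nnegrE ?divr_ge0 ?sqr_ge0// ltW.
  apply: (@le_trans _ _ ((E * y) ^+ 3)).
    by rewrite lerXn2r ?nnegrE ?mulr_ge0 ?(ltW z0)// ltW.
  rewrite exprMn (_ : 24 * _ = E ^+ 3 * (6 * E)); last by field.
  by rewrite ler_wpM2l ?exprn_ge0 ?(ltW E0)//; lra.
Qed.

(** Since [ln (c^(k+1))] is linear in [k], these probabilities have a divergent sum. *)
Lemma Pr_shell_level : exists2 h0 : R, 0 < h0 &
  \forall k \near \oo, forall N : nat, (c ^ k.+1 <= N)%N ->
    h0 / k.+1%:R <= Pr (fun _ : 'I_N * 'I_N => p)
      (fun x => level k <= Sset p (shell (c ^ k) (c ^ k.+1)) x).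
Proof.
have /andP[p0 p1] := hp.
have lnc : 0 < ln c%:R :> R by rewrite ln_gt0// ltr1n.
pose C := 6 / (1 - p) ^+ 2 + 3 / p ^+ 3.
have C0 : 0 <= C.
  by rewrite addr_ge0// divr_ge0 ?sqr_ge0// exprn_ge0// ltW.
exists (2^-1 * expR (- (C * 24)) / ln c%:R).
  by rewrite divr_gt0 ?mulr_gt0 ?expR_gt0.
near=> k => N cN.
pose E : R := (c ^ k.+1)%:R.
pose y : R := ln E.
have Epos : 0 < E by rewrite ltr0n expn_gt0 ltnW.
have yE : y = k.+1%:R * ln c%:R by rewrite /y /E natrX lnXn// mulr_natl.
have ybig (b : R) : b / ln c%:R <= k%:R -> b <= y.
  rewrite ler_pdivrMr// => h; rewrite yE (le_trans h)// ler_wpM2r ?(ltW lnc)//.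
  by rewrite ler_nat.
have y1 : 1 <= y by apply: ybig; near: k; exact: nbhs_infty_ger.
have yp : 16 / (1 - p) <= y by apply: ybig; near: k; exact: nbhs_infty_ger.
have ye : expR (((dl / 16) ^+ 2 * sigma ^+ 2)^-1) <= y.
  by apply: ybig; near: k; exact: nbhs_infty_ger.
have ME : #|@shell N (c ^ k) (c ^ k.+1)|%:R = E ^+ 2 * (1 - (c%:R ^+ 2)^-1) :> R.
  rewrite card_shell// ?leq_exp2l// mulrBr mulr1; congr (_ - _).
  by rewrite /E expnS natrM exprMn; field; rewrite gt_eqF.
have EE : E = expR y by rewrite /y lnK.
have [M0 z0 H1 H2 [H3 H4]] := shell_tilt_conditions ME EE y1 yp ye.
have y0 : 0 < y by lra.
have eta01 : 0 < dl / 16 <= 1.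
  by have := dl0; have := dl1 => *; apply/andP; split; lra.
apply: le_trans (Sset_lower_tail hp _ eta01 z0 H1 H2); last by rewrite -(ltr_nat R).
rewrite [leLHS](_ : _ = 2^-1 * (expR (- (C * 24)) / (k.+1%:R * ln c%:R))); last first.
  by field; rewrite !gt_eqF.
rewrite ler_wpM2l//.
apply: (@le_trans _ _ (expR (- (C * 24) - ln y))).
  by rewrite expRD [expR (- ln y)]expRN lnK ?posrE// yE.
rewrite ler_expR -opprD lerN2 [leRHS]addrC.
by apply: lerD; [exact: H3|apply: ler_wpM2l].
Unshelve. all: by end_near. Qed.

(** As in the second Borel-Cantelli lemma, the probability that no shell between
    [k0] and [k1] reaches its level is a product of factors [1 - h0 / (k + 1)], at most
    the exponential of a divergent harmonic sum. *)
Lemma lil_shells : \forall t \ae P, forall k0, exists2 k, (k0 <= k)%N &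
  level k <= surplus p G (c ^ k.+1) t - surplus p G (c ^ k) t.
Proof.
have [h0 h00 [K0 _ HK]] := Pr_shell_level.
pose m k := (c ^ k)%N.
have mm : {homo m : k l / (k <= l)%N} by move=> k l kl; rewrite leq_exp2l.
pose L k t := level k <= surplus p G (m k.+1) t - surplus p G (m k) t.
pose A k0 := \bigcap_(k in [set k | (k0 <= k)%N]) [set t | ~~ L k t].
have LE N k t : (m k.+1 <= N)%N ->
    L k t = (level k <= Sset p (shell (m k) (m k.+1)) (restr G N t)).
  move=> mN; rewrite /L Sset_shell ?mm// -!(surplus_box p G)//.
  by apply: leq_trans mN; exact: mm.
have mA k0 : measurable (A k0).
  apply: bigcap_measurableType => k _.
  rewrite (_ : [set t | _] = [set t | ~~ (level k <= Sset p (shell (m k) (m k.+1)) (restr G (m k.+1) t))]).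
    by have [] := restr_prob hG (fun x : {ffun 'I_(m k.+1) * 'I_(m k.+1) -> bool} =>
       ~~ (level k <= Sset p (shell (m k) (m k.+1)) x)).
  by apply/seteqP; split=> t /=; rewrite (LE (m k.+1)).
have A0 k0 : (K0 <= k0)%N -> P (A k0) = 0%E.
  move=> Kk0; apply/eqP; rewrite eq_le measure_ge0 andbT.
  apply/lee_addgt0Pr => e e0; rewrite add0e.
  have [k1 Hk1] := @harmonic_unbounded R k0 (- ln e / h0).
  pose N := m k1.
  pose f k (x : {ffun 'I_N * 'I_N -> bool}) := ~~ (level k <= Sset p (shell (m k) (m k.+1)) x).
  pose Q x := all (fun k => f k x) (index_iota k0 k1).
  have [mQ PQ] := restr_prob hG Q.
  have AQ : A k0 `<=` [set t | Q (restr G N t)].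
    move=> t At; apply/allP => k; rewrite mem_index_iota => /andP[k0k kk1].
    by rewrite /f -LE; [exact: At|exact: mm].
  have : (P (A k0) <= P [set t | Q (restr G N t)])%E by apply: le_measure; rewrite ?inE.
  rewrite PQ => hA; apply: (le_trans hA); rewrite lee_fin.
  have -> : Pr (fun=> p) Q = \prod_(k0 <= k < k1) Ex (fun _ : 'I_N * 'I_N => p) (fun x => (f k x)%:R).
    rewrite -(Ex_shells _ (m := m) (f := fun k x => (f k x)%:R))//.
      apply: eq_Ex => x; rewrite /Q /index_iota; elim: (iota _ _) => [|k s ih].
        by rewrite big_nil.
      by rewrite /= big_cons -ih; case: (f k x); rewrite /= ?mul1r ?mul0r.
    move=> k x y xy; rewrite /f; congr (~~ (_ <= _))%:R.
    by apply: eq_bigr => ij hij; rewrite xy.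
  apply: (@le_trans _ _ (\prod_(k0 <= k < k1) expR (- (h0 * (k.+1%:R)^-1)))).
    rewrite big_nat [leRHS]big_nat; apply: ler_prod => k /andP[k0k kk1].
    rewrite (Pr_ge0 (fun _ => p01) (f k))/=.
    rewrite -/(Pr _ (f k)) Pr_C.
    apply: le_trans (expR_ge1Dx _); rewrite lerD2l lerN2.
    by apply: HK; [exact: leq_trans k0k|exact: mm].
  rewrite -(expR_sum _ (fun=> true) (fun k => - (h0 * (k.+1%:R)^-1))).
  rewrite sumrN -big_distrr/= -[leRHS]lnK ?posrE// ler_expR lerNl.
  by move: Hk1; rewrite ler_pdivrMr// mulrC.
apply: (@negligibleS _ _ _ _ (\bigcup_k0 A (maxn K0 k0))).
  move=> t /= /existsNP[k0 Hk0]; exists k0 => // k /=; rewrite geq_max => /andP[_ k0k].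
  by apply/negP => Lk; apply: Hk0; exists k.
apply: negligible_bigcup => k0; apply/negligibleP; first exact: mA.
by apply: A0; rewrite leq_maxl.
Qed.

(** The previous square contributes at least [- 2 sigma c^k sqrt (2 log log)] by the upper
    half with sign -1, and [2 / c <= dl / 2]. *)
Lemma lil_lower_base : \forall t \ae P, forall n0, exists2 n, (n0 <= n)%N &
  (1 - dl) * sigma * n%:R * sqrt2ln (ln n%:R) <= surplus p G n t.
Proof.
have eN1 : `|-1| = 1 :> R by rewrite normrN normr1.
apply: filterS2 lil_shells (lil_upper hp hG eN1 ltr01) => t Hs [n1 _ Hu] n0.
have lnc : 0 < ln c%:R :> R by rewrite ln_gt0// ltr1n.
pose k0 := (maxn (maxn n0 n1) (Num.truncn (1 / ln (c%:R : R))).+1).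
have [k k0k Lk] := Hs k0.
have kc : (k <= c ^ k)%N by apply: ltnW; exact: ltn_expl.
have ckc : (c ^ k <= c ^ k.+1)%N by rewrite leq_exp2l.
exists (c ^ k.+1)%N.
  apply: leq_trans ckc; apply: leq_trans kc; apply: leq_trans k0k.
  by rewrite /k0 -maxnA leq_maxl.
have n1k : (n1 <= c ^ k)%N.
  apply: leq_trans kc; apply: leq_trans k0k.
  by rewrite /k0 (leq_trans (leq_maxr n0 n1))// leq_maxl.
have := Hu _ n1k.
have s0 := sigma_gt0 hp.
have c0' : 0 < (c ^ k)%:R :> R by rewrite ltr0n expn_gt0 ltnW.
have y1 : 1 <= ln (c ^ k)%:R :> R.
  rewrite natrX lnXn// -(mulr_natl (ln _)) -ler_pdivrMr//.
  apply: ltW; apply: (lt_le_trans (truncnS_gt _)); rewrite ler_nat.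
  by apply: leq_trans k0k; rewrite leq_maxr.
have ymono : ln (c ^ k)%:R <= ln (c ^ k.+1)%:R :> R.
  by rewrite ler_ln ?posrE ?ler_nat// ltr0n expn_gt0 ltnW.
have smono := sqrt2ln_mono y1 ymono.
move: Lk; rewrite /level.
set S1 := sqrt2ln (ln (c ^ k.+1)%:R) in smono *; set S0 := sqrt2ln _ in smono *.
have S10 : 0 <= S1 by exact: sqrt2ln_ge0.
set V1 := surplus _ _ _ _; set V0 := surplus _ _ _ _ => h1 h2.
have h3 : 2 * sigma * (c ^ k)%:R * S0 <= dl / 2 * sigma * (c ^ k.+1)%:R * S1.
  rewrite expnS natrM.
  apply: ler_pM => //; rewrite ?mulr_ge0 ?(ltW s0) ?sqrt2ln_ge0//.
  rewrite mulrA ler_wpM2r// mulrAC ler_wpM2r ?(ltW s0)//.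
  by move: c_ge; rewrite ler_pdivrMr//; lra.
lra.
Qed.

End Lower.

Lemma lil_lower {R : realType} {d : measure_display} {T : measurableType d}
    (P : probability T R) (p : R) (hp : 0 < p < 1) (G : nat * nat -> {RV P >-> bool})
    (hG : random_bipartite_graph p G) (dl : R) : 0 < dl <= 1 ->
  \forall t \ae P, forall n0, exists2 n, (n0 <= n)%N &
  (1 - dl) * sigma p * n%:R * sqrt2ln (ln n%:R) <= surplus p G n t.
Proof.
move=> dl01; apply: (@lil_lower_base _ _ _ _ _ hp _ hG _ (Num.truncn (4 / dl)).+1) => //.
by apply: ltW; exact: truncnS_gt.
Qed.

(** * The limit superior of the normalised log-permanent *)

Lemma sqrt2ln_infty {R : realType} (B : R) : \forall n \near \oo, B <= sqrt2ln (ln n%:R).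
Proof.
near=> n.
have nE : expR (expR (B ^+ 2)) <= n%:R by near: n; exact: nbhs_infty_ger.
have n0 : 0 < n%:R :> R by apply: lt_le_trans nE; exact: expR_gt0.
have ln1' : expR (B ^+ 2) <= ln n%:R by rewrite -[leLHS]expRK ler_ln ?posrE ?expR_gt0.
have ln0' : 0 < ln n%:R :> R by apply: lt_le_trans ln1'; exact: expR_gt0.
have lnln : B ^+ 2 <= ln (ln n%:R) by rewrite -[leLHS]expRK ler_ln ?posrE ?expR_gt0.
rewrite (le_trans (ler_norm B))// -sqrtr_sqr ler_wsqrtr//.
by have := sqr_ge0 B; lra.
Unshelve. all: by end_near. Qed.

Section Final.
Context {R : realType} {d : measure_display} {T : measurableType d}.
Variables (P : probability T R) (p : R).
Hypothesis hp : 0 < p < 1.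
Variable G : nat * nat -> {RV P >-> bool}.
Hypothesis hG : random_bipartite_graph p G.

Definition ratio n t : \bar R :=
  ((Y G n t - (ln (n`!%:R * p ^+ n))%:E)
        / (Num.sqrt (2 * ln (ln n%:R)) * Num.sqrt ((1 - p) / p))%:E)%E.

Lemma sqrt_odds : Num.sqrt ((1 - p) / p) = sigma p / p.
Proof.
have /andP[p0 p1] := hp; have s0 := sigma_gt0 hp.
rewrite -[RHS]ger0_norm ?divr_ge0 ?(ltW s0) ?(ltW p0)// -sqrtr_sqr; congr Num.sqrt.
by rewrite exprMn sigma_sqr//; field; rewrite gt_eqF.
Qed.

Lemma ratio_typical n t : (0 < n)%N -> 0 < sqrt2ln (ln n%:R : R) -> typical p (restr G n t) ->
  exists2 r : R, ratio n t = r%:E &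
   `|r - surplus p G n t / (sigma p * n%:R * sqrt2ln (ln n%:R))| <=
   (1 + 4 / p ^+ 2) / (sqrt2ln (ln n%:R) * (sigma p / p)).
Proof.
move=> n0 L0 ty; have [X0 H] := typicalP n0 ty.
have /andP[p0 p1] := hp; have s0 := sigma_gt0 hp.
have nR0 : 0 < n%:R :> R by rewrite ltr0n.
exists ((ln (X G n t)%:R - ln (n`!%:R * p ^+ n)) / (sqrt2ln (ln n%:R) * (sigma p / p))).
  rewrite /ratio /Y lne_EFin ?ltr0n// sqrt_odds -/(sqrt2ln _) inver ifF; last first.
    by rewrite gt_eqF// mulr_gt0// divr_gt0.
  by rewrite -EFinB -EFinM.
have D0 : 0 < sqrt2ln (ln n%:R) * (sigma p / p) by rewrite mulr_gt0// divr_gt0.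
rewrite [X in `|_ - X|](_ : _ = surplus p G n t / (n%:R * p) / (sqrt2ln (ln n%:R) * (sigma p / p))); last first.
  by field; rewrite !gt_eqF.
by rewrite -mulrBl normrM normfV (gtr0_norm D0) ler_wpM2r// invr_ge0 ltW.
Qed.

(** Dividing by [sqrt (2 log log n)], which tends to infinity, removes the bounded error
    of the comparison. *)
Lemma limn_esup_ratio t :
  (\forall n \near \oo, typical p (restr G n t)) ->
  (forall k : nat, \forall n \near \oo,
    1 * surplus p G n t <= (1 + k.+1%:R^-1) * sigma p * n%:R * sqrt2ln (ln n%:R)) ->
  (forall k n0 : nat, exists2 n, (n0 <= n)%N &
    (1 - k.+1%:R^-1) * sigma p * n%:R * sqrt2ln (ln n%:R) <= surplus p G n t) ->
  limn_esup (ratio ^~ t) = 1%E.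
Proof.
move=> Ht Hu Hl; have /andP[p0 p1] := hp; have s0 := sigma_gt0 hp.
pose C : R := 1 + 4 / p ^+ 2.
have C0 : 0 < C by rewrite ltr_wpDr// divr_ge0// sqr_ge0.
have small (e : R) : 0 < e -> exists k : nat, k.+1%:R^-1 <= e / 2.
  move=> e0; exists (Num.truncn (2 / e)).
  rewrite -[leRHS]invrK lef_pV2 ?posrE ?invr_gt0 ?divr_gt0// invf_div.
  by apply: ltW; exact: truncnS_gt.
have big (e : R) : 0 < e -> \forall n \near \oo, [/\ (0 < n)%N, 0 < sqrt2ln (ln n%:R : R) &
    C / (sqrt2ln (ln n%:R) * (sigma p / p)) <= e / 2].
  move=> e0; near=> n.
  have n0 : (0 < n)%N by near: n; exact: nbhs_infty_gt.
  have L1 : 1 <= sqrt2ln (ln n%:R) :> R by near: n; exact: sqrt2ln_infty.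
  have L2 : C / (e / 2) / (sigma p / p) <= sqrt2ln (ln n%:R) by near: n; exact: sqrt2ln_infty.
  have L0 : 0 < sqrt2ln (ln n%:R : R) by lra.
  split => //.
  have sp0 : 0 < sigma p / p by rewrite divr_gt0.
  rewrite ler_pdivrMr; last exact: mulr_gt0.
  by move: L2; rewrite ler_pdivrMr// ler_pdivrMr ?divr_gt0// mulrC.
have sE n (L x : R) : (0 < n)%N -> 0 < L -> x * sigma p * n%:R * L = x * (sigma p * n%:R * L).
  by move=> *; ring.
apply: limn_esup_eq1 => [e e0|e N e0].
  have [k ke] := small e e0.
  have Hb := big e e0; have Huk := Hu k.
  near=> n.
  have [n0 L0 Cb] : [/\ (0 < n)%N, 0 < sqrt2ln (ln n%:R : R) &
    C / (sqrt2ln (ln n%:R) * (sigma p / p)) <= e / 2] by near: n.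
  have Hn : 1 * surplus p G n t <= (1 + k.+1%:R^-1) * sigma p * n%:R * sqrt2ln (ln n%:R) by near: n.
  have ty : typical p (restr G n t) by near: n.
  have [r -> Hr] := ratio_typical n0 L0 ty.
  have D0 : 0 < sigma p * n%:R * sqrt2ln (ln n%:R) by rewrite !mulr_gt0// ltr0n.
  rewrite lee_fin.
  have h1 : surplus p G n t / (sigma p * n%:R * sqrt2ln (ln n%:R)) <= 1 + k.+1%:R^-1.
    by rewrite ler_pdivrMr// -sE// -[leLHS]mul1r.
  have h2 := le_trans (ler_norm _) Hr; rewrite -/C in h2.
  have := le_trans h2 Cb; rewrite lerBlDr => h3; apply: (le_trans h3).
  apply: (le_trans (lerD (lexx _) h1)).
  by move: ke; move: (k.+1%:R^-1) => kk *; lra.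
have [k ke] := small e e0.
have [n1 _ H1] := big e e0; have [n2 _ H2] := Ht.
have [n nn Hn] := Hl k (maxn N (maxn n1 n2)).
move: nn; rewrite !geq_max => /and3P[Nn n1n n2n].
have [n0 L0 Cb] := H1 n n1n.
have [r rE Hr] := ratio_typical n0 L0 (H2 n n2n).
exists n => //; rewrite rE lee_fin.
have D0 : 0 < sigma p * n%:R * sqrt2ln (ln n%:R) by rewrite !mulr_gt0// ltr0n.
have h1 : 1 - k.+1%:R^-1 <= surplus p G n t / (sigma p * n%:R * sqrt2ln (ln n%:R)).
  by rewrite ler_pdivlMr// -sE.
move: Hr; rewrite ler_norml -/C => /andP[h2 _].
have h3 : - (e / 2) <= r - surplus p G n t / (sigma p * n%:R * sqrt2ln (ln n%:R)).
  by apply: le_trans h2; rewrite lerN2.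
move: h1 h3 ke; move: (k.+1%:R^-1) (surplus p G n t / _) => kk S *; lra.
Unshelve. all: by end_near. Qed.

(** Only the finite subgraph matters, so the ratio factors through [restr]. *)
Lemma measurable_ratio n : measurable_fun (setT : set T) (ratio n : T -> \bar R).
Proof.
have rr t t' : restr G n t = restr G n t' -> ratio n t = ratio n t'.
  by move=> tt'; rewrite /ratio /Y (X_restr tt').
(* configurations that no outcome realises get the value 0 *)
pose g x : \bar R := if pselect (exists t, restr G n t = x) is left h
  then ratio n (projT1 (cid h)) else 0%E.
apply: (@measurable_fun_restr _ _ _ _ p G hG n _ _ _ g) => t; rewrite /g.
case: pselect => [h|[]]; last by exists t.
by apply: rr; rewrite (projT2 (cid h)).
Qed.

End Final.

Theorem theorem2p1 (R : realType) (d : measure_display) (T : measurableType d)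
    (P : probability T R) (p : R) (hp : 0 < p < 1)
    (G : nat * nat -> {RV P >-> bool}) (hG : random_bipartite_graph p G) :
  P [set t : T |
     limn_esup (fun n : nat =>
       ((Y G n t - (ln (n`!%:R * p ^+ n))%:E)
        / (Num.sqrt (2 * ln (ln n%:R)) * Num.sqrt ((1 - p) / p))%:E)%E)
     = 1%E] = 1%E.
Proof.
rewrite -[X in P X]/[set t | limn_esup (ratio p G ^~ t) = 1%E].
set A := [set t | _].
have mA : measurable A.
  rewrite -[X in measurable X]setTI.
  have := @measurable_fun_limn_esup _ T R setT (ratio p G).
  move=> /(_ (fun n => measurable_ratio hG n) measurableT [set 1%E]).
  by apply; exact: emeasurable_set1.
have aeA : \forall t \ae P, A t.
  have inv_gt0 k : 0 < k.+1%:R^-1 :> R by rewrite invr_gt0 ltr0n.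
  have inv01 k : 0 < (k.+1%:R : R)^-1 <= 1.
    by rewrite inv_gt0 invf_le1 ?ltr0n// ler1n.
  have up : \forall t \ae P, forall k : nat, \forall n \near \oo,
    1 * surplus p G n t <= (1 + k.+1%:R^-1) * sigma p * n%:R * sqrt2ln (ln n%:R).
    by apply/ae_foralln => k; apply: lil_upper => //; rewrite normr1.
  have lo : \forall t \ae P, forall k n0 : nat, exists2 n, (n0 <= n)%N &
    (1 - k.+1%:R^-1) * sigma p * n%:R * sqrt2ln (ln n%:R) <= surplus p G n t.
    by apply/ae_foralln => k; exact: lil_lower.
  apply: filterS3 (ae_typical hp hG) up lo => t; exact: limn_esup_ratio.
have : P (~` A) = 0%E by apply/negligibleP; [exact: measurableC|exact: aeA].
rewrite probability_setC// => h.
by move/eqP: h; rewrite sube_eq ?fin_num_measure// add0e eq_sym => /eqP.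
Qed.
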